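(* Suppose $(X,\sum(1/n_i)C_i)$ is an orbifold pair of volume $0$, with at least one $n_i\ge2$. Then the graph of the minimal orbifold log resolution is one of the following (all exceptional curves being smooth and rational): (1) $E$ is a chain of rational curves, with the $\tilde C_i$ (at most two of them) meeting the ends of the chain transversally (one at each end), with arbitrary weights $n_i$ on the ends. (2) $E$ is star-shaped with three branches: a central curve, two branches each consisting of a single $-2$ curve met by no $\tilde C_i$, and a third branch which is a chain of rational curves whose end curve meets the only curve $\tilde C$, with arbitrary weight $n$. (3) $E$ consists of a chain of rational curves $F_1,\dots,F_k$, $k\geq2$, together with two further curves attached to $F_1$ and two further curves attached to $F_k$; each of these four curves is either a $-1$ curve met by one $\tilde C_i$ of weight $n_i=2$, or a $-2$ curve met by no $\tilde C_i$. (4) $E$ is star-shaped with a central curve and four branches, each branch being a single curve which is either a $-1$ curve met by one $\tilde C_i$ of weight $n_i=2$, or a $-2$ curve met by no $\tilde C_i$. (5) $E$ is star-shaped with a central curve and exactly three branches, whose determinants $m_i$ and weights $n_i$ ($i=1,2,3$), suitably ordered so that $n_1m_1\le n_2m_2\le n_3m_3$, satisfy that $(n_1m_1,n_2m_2,n_3m_3)$ is one of: $(2,2,k)$ with $k\ge2$; $(2,3,k)$ with $3\le k\le6$; $(2,4,4)$; $(3,3,3)$.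
   Context: An orbifold pair $(X,C=\sum_{i=1}^r(1/n_i)C_i)$ consists of a germ $(X,0)$ of a complex normal surface (possibly smooth), distinct irreducible Weil divisors $C_i$ (curve germs through $0$), and positive integers $n_i$ (the weights). Components with $n_i=1$ are omitted when forming resolutions. A good resolution $\pi:(\tilde X,E)\to(X,0)$ is one whose reduced exceptional divisor $E=\pi^{-1}(0)=\bigcup E_j$ (non-empty) has smooth components and normal crossings; a log resolution is a good resolution such that $E\cup\pi^{-1}(\bigcup C_i)$ has simple normal crossings, and $\tilde C_i$ is the strict transform of $C_i$. An end curve of $E$ is a component meeting exactly one other component. The minimal orbifold log resolution is the minimal log resolution with the property that every $\tilde C_i$ meets an end curve of $E$ and each end curve meets at most one $\tilde C_i$ (when $E$ is a single curve it may be met by up to two $\tilde C_i$). Each $\mathbb Q$-divisor on $\tilde X$ is identified with the unique exceptional $\mathbb Q$-divisor having the same intersection number with every $E_j$. Every exceptional $\mathbb Q$-divisor $L$ has a unique Zariski decomposition $L=P+N$ with $P\cdot E_j\ge0$ for all $j$, $N$ effective, and $P\cdot E_j=0$ for $E_j\subset\mathrm{Supp}\,N$. The volume is $Vol(X,C):=-P_{\bar C}\cdot P_{\bar C}$, where $K_{\tilde X}+E+\sum(1-1/n_i)\tilde C_i=P_{\bar C}+N_{\bar C}$ is the Zariski decomposition on any log resolution. A star-shaped graph consists of a central curve with branches (strings of smooth rational curves) emanating from it. The determinant $m$ of a branch is the absolute value of the determinant of its intersection matrix; $m=1$ exactly when the branch is a single $-1$ curve. The weight $n_i$ of a branch is the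 weight of the curve whose strict transform meets the end of that branch, with $n_i=1$ if there is none. *)

(* Defs.v *)
From HB Require Import structures.
From mathcomp Require Import all_boot all_order all_algebra.
From Stdlib Require Relation_Operators.

Set Implicit Arguments.
Unset Strict Implicit.
Unset Printing Implicit Defensive.

Import Order.TTheory GRing.Theory Num.Theory.
Local Open Scope ring_scope.

(* The curves C_i with 1 < n_i: those of weight 1 are omitted when resolving. *)
Notation orb n := {i | 1 < n i}%N.

(* A Q-divisor supported on E, by its coefficients. *)
Definition qdot (V : finType) (inter : V -> V -> int) (D D' : {ffun V -> rat}) :
    rat :=
  \sum_j \sum_k D j * D' k * (inter j k)%:~R.

(* A log resolution (Xt, E) -> (X, 0) of a pair (X, sum_i (1/n_i) C_i),
   recorded by its weighted dual graph.  By Zariski's main theorem E is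
   connected, by Mumford its intersection matrix is negative definite, and
   by Grauert all the data below do come from a normal surface germ.
   E_j . E_k >= 2 is allowed for j != k: the components of E are smooth and E
   has normal crossings, but two components may meet in several points.
   The strict transform of the (irreducible) curve C_i meets E transversally in
   a single point, which lies on no other component and on no other strict
   transform; so it is determined by the component [foot i] that it meets. *)
Record log_resolution (r : nat) (n : 'I_r -> nat) := LogResolution {
  ecomp : finType;
  inter : ecomp -> ecomp -> int;
  genus : ecomp -> nat;
  foot : orb n -> ecomp;
  ecomp_gt0 : (0 < #|ecomp|)%N;
  interC : forall j k, inter j k = inter k j;
  inter_ge0 : forall j k, j != k -> 0 <= inter j k;
  ecomp_connected :
    forall j k, connect (fun a b => (a != b) && (inter a b != 0)) j k;
  inter_negdef : forall D : {ffun ecomp -> rat}, D != 0 -> qdot inter D D < 0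
}.

Arguments inter {r n l} j k : rename.
Arguments genus {r n l} j : rename.
Arguments foot {r n l} i : rename.

Section LogResolution.
Variables (r : nat) (n : 'I_r -> nat).
Implicit Types G : log_resolution n.

Definition meets G (j k : ecomp G) : bool := (j != k) && (inter j k != 0).

Definition end_curve G (j : ecomp G) : bool := #|[set k | meets j k]| == 1%N.

Definition unmet G (j : ecomp G) : Prop := forall i, foot i <> j.

(* G' is obtained from G by contracting the (-1)-curve v to a point, the result
   being again a log resolution: the images of the other curves of E are smooth
   (they meet v at most once), and at most two branches of the images of E and
   of the C_i pass through the image of v.  [f] is the strict transform on
   components; E'_a . E'_b = pi^* E'_a . pi^* E'_b gives the intersection
   numbers, and a strict transform meeting v then meets the neighbour of v. *)
Definition contracts_to G G' : Prop :=
  exists (v : ecomp G) (f : ecomp G' -> ecomp G),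
  [/\ [/\ genus v = 0%N, inter v v = -1,
          (forall w, w != v -> inter v w <= 1) &
          \sum_(w | w != v) inter v w + #|[set i | foot i == v]|%:Z <= 2],
      [/\ injective f, (forall a, f a != v) &
          (forall w, w != v -> exists a, w = f a)],
      (forall a, genus a = genus (f a)),
      (forall a b, inter a b =
         inter (f a) (f b) + inter (f a) v * inter (f b) v) &
      (forall i : orb n,
         if foot i == v :> ecomp G then inter v (f (foot i)) = 1
         else f (foot i) = foot i)].

Definition orbifold_log G : Prop :=
  if #|ecomp G| == 1%N then is_true (#|{: orb n}| <= 2)%N
  else (forall i : orb n, end_curve (foot i : ecomp G)) /\
       (forall j : ecomp G, end_curve j -> (#|[set i | foot i == j]| <= 1)%N).

Definition minimal_orbifold_log G : Prop :=
  orbifold_log G /\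
  forall G', Relation_Operators.clos_trans _ contracts_to G G' ->
             ~ orbifold_log G'.

Definition dotE G (D : {ffun ecomp G -> rat}) (j : ecomp G) : rat :=
  \sum_k D k * (inter k j)%:~R.

(* K . E_j, by adjunction *)
Definition canon_dot G (j : ecomp G) : int :=
  (2 * genus j)%:Z - 2 - inter j j.

(* (K + E + \sum_i (1 - 1/n_i) Ct_i) . E_j *)
Definition log_canon_dot G (j : ecomp G) : rat :=
  (canon_dot j)%:~R + \sum_k (inter k j)%:~R
    + \sum_(i : orb n | foot i == j) (1 - (n (val i))%:R^-1).

Definition zariski G (L P N : {ffun ecomp G -> rat}) : Prop :=
  [/\ L = P + N,
      forall j, 0 <= dotE P j,
      forall j, 0 <= N j &
      forall j, N j != 0 -> dotE P j = 0].

(* L is the exceptional Q-divisor identified with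
   K + E + \sum_i (1 - 1/n_i) Ct_i. *)
Definition has_volume G (vol : rat) : Prop :=
  exists L P N : {ffun ecomp G -> rat},
    [/\ forall j, dotE L j = log_canon_dot j,
        zariski L P N &
        vol = - qdot (@inter _ _ G) P P].

(* The components of E are those listed in [s], and two of them meet (in one
   point) exactly when they form one of the edges [es]. *)
Definition graph_is G (s : seq (ecomp G)) (es : seq (ecomp G * ecomp G)) : Prop :=
  [/\ uniq s, (forall j, j \in s) &
      forall j k, j != k ->
        inter j k = (((j, k) \in es) || ((k, j) \in es) : nat)%:Z].

Definition chain_edges (T : Type) (s : seq T) : seq (T * T) :=
  zip s (behead s).

Definition is_chain G (s : seq (ecomp G)) : Prop := graph_is s (chain_edges s).

(* Each branch is listed starting from the curve that meets the center [c]. *)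
Definition is_star G (c : ecomp G) (bs : seq (seq (ecomp G))) : Prop :=
  all (fun b => b != [::]) bs /\
  graph_is (c :: flatten bs) (flatten [seq chain_edges (c :: b) | b <- bs]).

Definition all_rational G : Prop := forall j : ecomp G, genus j = 0%N.

Definition branch_det G (b : seq (ecomp G)) : nat :=
  `|\det (\matrix_(i < size b, j < size b)
            inter (tnth (in_tuple b) i) (tnth (in_tuple b) j))|%N.

(* The branch with end curve j has weight 1 if no strict transform meets j. *)
Definition end_weight G (j : ecomp G) : nat :=
  if [pick i | foot i == j] is Some i then n (val i) else 1%N.

Definition branch_weight G (c : ecomp G) (b : seq (ecomp G)) : nat :=
  end_weight (last c b).

Definition half_tail G (x : ecomp G) : Prop :=
  (inter x x = -1 /\
     exists i, (forall k, foot k = x <-> k = i) /\ n (val i) = 2%N) \/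
  (inter x x = -2 /\ unmet x).

(* The injection e assigns to each strict transform its own end of the chain
   (when the chain is one curve, its two ends are the same curve). *)
Definition chain_case G : Prop :=
  exists (x : ecomp G) (s : seq (ecomp G)) (e : orb n -> bool),
    [/\ is_chain (x :: s), injective e &
        forall i, foot i = if e i then last x s else x].

Definition dihedral_case G : Prop :=
  exists (c x1 x2 z : ecomp G) (b : seq (ecomp G)) (i : orb n),
    [/\ is_star c [:: [:: x1]; [:: x2]; rcons b z],
        inter x1 x1 = -2 /\ unmet x1,
        inter x2 x2 = -2 /\ unmet x2,
        foot i = z &
        forall k : orb n, k = i].

Definition two_node_case G : Prop :=
  exists (a1 a2 b1 b2 F1 Fk : ecomp G) (F : seq (ecomp G)),
    let chain := F1 :: rcons F Fk in
    [/\ graph_is ([:: a1; a2; b1; b2] ++ chain)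
          (chain_edges chain ++ [:: (a1, F1); (a2, F1); (b1, Fk); (b2, Fk)]),
        (forall x, x \in [:: a1; a2; b1; b2] -> half_tail x) &
        (forall i, foot i \in [:: a1; a2; b1; b2])].

Definition four_branch_case G : Prop :=
  exists c x1 x2 x3 x4 : ecomp G,
    [/\ is_star c [:: [:: x1]; [:: x2]; [:: x3]; [:: x4]],
        (forall x, x \in [:: x1; x2; x3; x4] -> half_tail x) &
        (forall i, foot i \in [:: x1; x2; x3; x4])].

Definition volume_zero_triple (p q s : nat) : Prop :=
  [\/ [/\ p = 2, q = 2 & 2 <= s],
      [/\ p = 2, q = 3 & 3 <= s <= 6],
      [/\ p = 2, q = 4 & s = 4] |
      [/\ p = 3, q = 3 & s = 3]]%N.

Definition three_branch_case G : Prop :=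
  exists (c : ecomp G) (b1 b2 b3 : seq (ecomp G)),
    let nm b := (branch_weight c b * branch_det b)%N in
    [/\ is_star c [:: b1; b2; b3],
        (forall i, foot i \in [:: last c b1; last c b2; last c b3]),
        (nm b1 <= nm b2 <= nm b3)%N &
        volume_zero_triple (nm b1) (nm b2) (nm b3)].

End LogResolution.

(* Main.v *)
From HB Require Import structures.
Require Import Defs.
From mathcomp Require Import all_boot all_order all_algebra.
From mathcomp Require Import zify ring lra.
From Stdlib Require Relation_Operators.

(** Volume zero means that the nef part vanishes, so the Q-divisor L with
    L.E_j = (K + E + sum (1 - 1/n_i) C_i).E_j is effective.  Prune from the dual
    graph all rational tails, that is, strings hanging from the remaining core U.
    Elimination along a tail with determinant m and weight n, attached at u,
    replaces it by a contribution 1/(nm) to the equation of L at u, so that the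
    reduced right-hand side at a core curve u of genus g and core valence t is
      2g - 2 + t + sum over the tails at u of (1 - 1/(nm)),
    and nm >= 2 for every tail, by minimality (a superfluous (-1)-curve could be
    contracted).  If U has at least two curves, all these numbers are >= 0;
    since the form is negative definite and L >= 0, L vanishes on U and they are
    all 0, which leaves a chain with two tails with nm = 2 at each end.  If U is
    a single curve, the number is <= 0: sum (1 - 1/(nm)) <= 2, which allows at
    most four tails.  The dihedral case is an instance of three tails. *)

Set Implicit Arguments.
Unset Strict Implicit.
Unset Printing Implicit Defensive.

Import Order.TTheory GRing.Theory Num.Theory.

(** * The intersection form *)

(** Effectivity of [L] is one-sided information. Comparing [L] with the solution [T] that vanishes
    on the core requires [T.E_u <= L.E_u] for all core curves [u] simultaneously, so the reduced
    numbers must not have mixed signs. This is why the peeling has to be maximal: a rational core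
    curve of valence 1 with at most one tail has a negative number, whereas two tails already give
    -2 + 1 + 2(1 - 1/2) = 0. With a single core curve there is only one number, and a positive one
    would be forced to be 0 by the same comparison. The hypothesis that some n_i is at least 2
    excludes the simple elliptic and the cusp graphs: on a single curve of positive genus it makes
    the right-hand side positive, and on a cycle of core curves it produces a tail. Valences are
    intersection numbers, so two curves meeting twice count as a cycle. *)

Section IntersectionForm.
Local Open Scope ring_scope.
Variables (r : nat) (n : 'I_r -> nat) (G : log_resolution n).
Implicit Types (D L T : {ffun ecomp G -> rat}) (j k : ecomp G).

Lemma qdotE D T : qdot (@inter _ _ G) D T = \sum_j D j * dotE T j.
Proof.
apply: eq_bigr => j _; rewrite /dotE mulr_sumr.
by apply: eq_bigr => k _; rewrite mulrA (interC j k).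
Qed.

Lemma qdot_ge0_eq0 D : 0 <= qdot (@inter _ _ G) D D -> D = 0.
Proof.
by move=> D2; apply/eqP; apply: contraTT D2 => /inter_negdef; rewrite ltNge.
Qed.

Lemma dotED D T j : dotE (D + T) j = dotE D j + dotE T j.
Proof.
by rewrite /dotE -big_split; apply: eq_bigr => k _; rewrite ffunE mulrDl.
Qed.

Lemma dotEN D j : dotE (- D) j = - dotE D j.
Proof.
by rewrite /dotE -sumrN; apply: eq_bigr => k _; rewrite ffunE mulNr.
Qed.

Lemma inter_lt0 j : inter j j < 0.
Proof.
have := @inter_negdef _ _ G [ffun k => (k == j)%:R].
rewrite qdotE (bigD1 j) //= ffunE eqxx mul1r big1 => [|k kj]; last first.
  by rewrite ffunE (negbTE kj) mul0r.
rewrite addr0 /dotE (bigD1 j) //= ffunE eqxx mul1r big1 => [|k kj]; last first.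
  by rewrite ffunE (negbTE kj) mul0r.
rewrite addr0 ltrz0; apply; apply/eqP => /ffunP /(_ j).
by rewrite !ffunE eqxx => /eqP; rewrite oner_eq0.
Qed.

(* Pairing [D] with its positive part gives [0 <= D^+ . D <= D^+ . D^+]. *)
Lemma nef_le0 D : (forall j, 0 <= dotE D j) -> forall j, D j <= 0.
Proof.
move=> Dnef; pose Dp : {ffun ecomp G -> rat} := [ffun j => Num.max (D j) 0].
suff /ffunP Dp0 : Dp = 0.
  by move=> j; have := Dp0 j; rewrite !ffunE => <-; rewrite le_max lexx.
apply: qdot_ge0_eq0; apply: (@le_trans _ _ (qdot (@inter _ _ G) Dp D)).
  by rewrite qdotE sumr_ge0 // => j _; rewrite mulr_ge0 // ffunE le_max lexx orbT.
apply: ler_sum => j _; apply: ler_sum => k _; rewrite !ffunE.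
have [->|jk] := eqVneq j k.
  by case: (leP (D k) 0) => // _; rewrite !mul0r.
rewrite -subr_ge0 -mulrBl mulr_ge0 ?ler0z ?inter_ge0 // -mulrBr mulr_ge0 //.
  by rewrite le_max lexx orbT.
by rewrite subr_ge0 le_max lexx.
Qed.

(* Solvable because the form restricted to the complement of [U] is
   nondegenerate. *)
Lemma dirichlet (U : {set ecomp G}) (f : ecomp G -> rat) :
  exists T, (forall j, j \in U -> T j = 0) /\
            (forall j, j \notin U -> dotE T j = f j).
Proof.
pose ev := @enum_val (ecomp G) predT; pose er := @enum_rank (ecomp G).
(* The columns in [U] are unit vectors and impose [x_b = 0]; the others impose the value of [dotE].
   A kernel vector has square 0, since one factor of each term [D j * dotE D j] vanishes. *)
pose A := \matrix_(a < #|{: ecomp G}|, b < #|{: ecomp G}|)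
  (if ev b \in U then (a == b)%:R else (inter (ev a) (ev b))%:~R : rat).
pose F (x : 'rV[rat]_#|{: ecomp G}|) : {ffun ecomp G -> rat} :=
  [ffun j => x 0 (er j)].
have AE x b : (x *m A) 0 b = if ev b \in U then x 0 b else dotE (F x) (ev b).
  rewrite mxE; case: ifP => bU.
    rewrite (bigD1 b) //= mxE bU eqxx mulr1 big1 ?addr0 // => a ab.
    by rewrite mxE bU (negbTE ab) mulr0.
  rewrite /dotE (reindex ev) /=; last first.
    by exists er => a _; [exact: enum_valK | exact: enum_rankK].
  by apply: eq_bigr => a _; rewrite mxE bU ffunE /er enum_valK.
have Au : A \in unitmx.
  rewrite -row_free_unit -kermx_eq0; apply/eqP/row_matrixP => i.
  rewrite row0; set x := row i _.
  have xA : x *m A = 0 by rewrite -row_mul mulmx_ker row0.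
  have xb b := AE x b; rewrite xA in xb.
  have /ffunP F0 : F x = 0.
    apply: qdot_ge0_eq0; rewrite qdotE sumr_ge0 // => j _.
    have := xb (er j); rewrite /ev /er enum_rankK mxE.
    by case: ifP => _ E; rewrite ?ffunE -E ?mul0r ?mulr0.
  apply/rowP => b; have := F0 (ev b); rewrite !ffunE /er /ev enum_valK => ->.
  by rewrite mxE.
pose y := \row_b (if ev b \in U then 0 else f (ev b)) *m invmx A.
have yE b := AE y b.
exists (F y); split=> j jU.
  by have := yE (er j); rewrite ffunE mulmxKV // mxE /ev enum_rankK jU.
by have := yE (er j); rewrite mulmxKV // mxE /ev enum_rankK (negbTE jU).
Qed.

Lemma volume0_effective : has_volume G 0 ->
  exists L, (forall j, dotE L j = log_canon_dot j) /\ (forall j, 0 <= L j).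
Proof.
move=> [L [P [N [LE [LPN _ N0 _] /esym/eqP]]]]; rewrite oppr_eq0 => /eqP P2.
exists L; split=> // j.
by rewrite LPN (@qdot_ge0_eq0 P) ?P2 // !ffunE add0r.
Qed.

(* If [L - T] is nef then it is [<= 0], so [L] vanishes on [U], and then
   [(L - T)^2 = 0]. *)
Lemma effective_eq (U : {set ecomp G}) L T :
  (forall j, 0 <= L j) -> (forall j, j \in U -> T j = 0) ->
  (forall j, j \notin U -> dotE T j = dotE L j) ->
  (forall j, j \in U -> dotE T j <= dotE L j) -> L = T.
Proof.
move=> L0 TU TE TL.
have BE j : dotE (L - T) j = dotE L j - dotE T j by rewrite dotED dotEN.
have LU j : j \in U -> L j = 0.
  move=> jU; apply/le_anti; rewrite L0 andbT.
  have := @nef_le0 (L - T); rewrite /= => /(_ _ j).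
  rewrite !ffunE (TU j jU) subr0; apply => k; rewrite BE subr_ge0.
  by have [kU|kU] := boolP (k \in U); [exact: TL | rewrite TE].
apply/eqP; rewrite -subr_eq0; apply/eqP/qdot_ge0_eq0.
rewrite qdotE big1 // => j _; rewrite BE !ffunE.
have [jU|jU] := boolP (j \in U); first by rewrite LU // TU // subrr mul0r.
by rewrite TE // subrr mulr0.
Qed.

Lemma connected_cut (S : {set ecomp G}) : S != set0 -> S != setT ->
  exists j k, [/\ j \in S, k \notin S & meets j k].
Proof.
move=> /set0Pn[x xS] ST; apply/'exists_'exists_and3P; apply: contraR ST => noedge.
have clS : closed (fun j k => (j != k) && (inter j k != 0)) (mem S).
  have stp j k : meets j k -> j \in S -> k \in S.
    move=> jk jS; apply: contraR noedge => kS.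
    by apply/'exists_'exists_and3P; exists j, k.
  by move=> j k jk; apply/idP/idP; apply: stp; rewrite // /meets eq_sym interC.
apply/eqP/setP => y; rewrite inE -(closed_connect clS (ecomp_connected x y)).
exact: xS.
Qed.

Lemma card_meets_le j :
  #|[set k | meets j k]|%:Z <= \sum_(k | k != j) inter j k.
Proof.
rewrite -sum1_card -natz natr_sum big_mkcond [leRHS]big_mkcond /=; apply: ler_sum => k _.
rewrite inE /meets eq_sym; have [//|jk /=] := eqVneq k j.
have : 0 <= inter j k by rewrite inter_ge0 // eq_sym.
have [->|] := eqVneq (inter j k) 0; rewrite ?mulr1n //=; lia.
Qed.

End IntersectionForm.

(** * Contraction of a (-1)-curve *)

Section Contraction.
Local Open Scope ring_scope.
Variables (r : nat) (n : 'I_r -> nat) (G : log_resolution n).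
Variables (v w0 : ecomp G).
Hypotheses (vv : inter v v = -1) (w0v : w0 != v) (vw0 : inter v w0 = 1).

Definition contr_comp : finType := {w : ecomp G | w \in predC1 v}.
Implicit Types a b : contr_comp.

Definition contr_inter a b : int :=
  inter (val a) (val b) + inter (val a) v * inter (val b) v.

(** The default [w0], reached only at [v], is what a C_i meeting [v] requires: after the contraction
    it meets the neighbour [w0] of [v]. *)
Definition contr_proj (j : ecomp G) : contr_comp :=
  insubd (exist (fun w => w \in predC1 v) w0 w0v : contr_comp) j.

Lemma contr_projK j : j != v -> val (contr_proj j) = j.
Proof. by move=> jv; rewrite insubdK. Qed.

Lemma contr_projv : val (contr_proj v) = w0.
Proof. by rewrite val_insubd inE eqxx. Qed.

Lemma contr_neq a : val a != v.
Proof. exact: (valP a). Qed.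

Lemma valK_contr a : contr_proj (val a) = a.
Proof. by apply/val_inj; rewrite contr_projK // contr_neq. Qed.

Lemma contr_interC a b : contr_inter a b = contr_inter b a.
Proof. by rewrite /contr_inter interC mulrC. Qed.

Lemma contr_inter_ge0 a b : a != b -> 0 <= contr_inter a b.
Proof.
by move=> ab; rewrite addr_ge0 ?mulr_ge0 ?inter_ge0 ?contr_neq // val_eqE.
Qed.

(** [T] is the pullback of [D]: as [v] has square -1, the coefficient [s] at [v] makes [T.v = 0],
    and only the strict transforms contribute to [T.T]. Negative definiteness of the contracted form
    follows. *)
Lemma contr_pull (D : {ffun contr_comp -> rat}) :
  exists2 T : {ffun ecomp G -> rat}, (forall a, T (val a) = D a) &
    qdot contr_inter D D = qdot (@inter _ _ G) T T.
Proof.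
pose s := \sum_b D b * (inter (val b) v)%:~R.
pose T : {ffun ecomp G -> rat} :=
  [ffun j => if j == v then s else D (contr_proj j)].
have TE a : T (val a) = D a by rewrite ffunE (negbTE (contr_neq a)) valK_contr.
have dotTE j : dotE T j =
    s * (inter v j)%:~R + \sum_b D b * (inter (val b) j)%:~R.
  rewrite /dotE (bigD1 v) //= ffunE eqxx; congr (_ + _).
  rewrite (big_sub (predC1 v) (fun k => T k * (inter k j)%:~R)).
  by apply: eq_bigr => b _; rewrite TE.
exists T => //; rewrite qdotE (bigD1 v) //= dotTE vv mulrN1 addNr mulr0 add0r.
rewrite (big_sub (predC1 v) (fun k => T k * dotE T k)) /=.
apply: eq_bigr => a _; rewrite TE dotTE mulr_suml mulrDr !mulr_sumr -big_split /=.
apply: eq_bigr => b _; rewrite /contr_inter (interC v) (interC (val b) (val a)).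
by rewrite intrD intrM; ring.
Qed.

Lemma contr_negdef (D : {ffun contr_comp -> rat}) :
  D != 0 -> qdot contr_inter D D < 0.
Proof.
move=> D0; have [T TD ->] := contr_pull D; apply: inter_negdef.
apply: contraNneq D0 => T0; apply/eqP/ffunP => a.
by rewrite -TD T0 !ffunE.
Qed.

Lemma contr_meetsE a b : (a != b) && (contr_inter a b != 0) =
  meets (val a) (val b) || [&& a != b, inter (val a) v != 0 & inter (val b) v != 0].
Proof.
rewrite /meets /contr_inter -val_eqE; have [//|ab /=] := eqVneq (\val a) (\val b).
rewrite paddr_eq0 ?mulr_ge0 // ?inter_ge0 // ?contr_neq //.
by rewrite mulf_eq0 !negb_and negb_or.
Qed.

(** Paths of [G] project to paths: the neighbours of [v] meet one another after the contraction, and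
    [v] goes to its neighbour [w0]. *)
Lemma contr_connected a b :
  connect (fun x y => (x != y) && (contr_inter x y != 0)) a b.
Proof.
set e := (fun x y => _); have eC : symmetric e.
  by move=> x y; rewrite /e eq_sym contr_interC.
have ev k : k != v -> inter v k != 0 -> connect e (contr_proj v) (contr_proj k).
  move=> kv vk; have [<-|pk] := eqVneq (contr_proj v) (contr_proj k).
    exact: connect0.
  apply: connect1; rewrite /e contr_meetsE pk contr_projv contr_projK //=.
  by rewrite !(interC _ v) vw0 vk orbT.
have stp j k : meets j k -> connect e (contr_proj j) (contr_proj k).
  move=> /andP[jk jk0]; have [jv|jv] := eqVneq j v.
    by subst j; apply: ev; rewrite // eq_sym.
  have [kv|kv] := eqVneq k v.
    by subst k; rewrite (sym_connect_sym eC); apply: ev; rewrite // interC.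
  by apply: connect1; rewrite /e contr_meetsE /meets !contr_projK // jk jk0.
rewrite -(valK_contr a) -(valK_contr b).
have /connectP[p] := ecomp_connected (val a) (val b).
move: (val a) => x; elim: p x => [|y p IHp] x /=; first by move=> _ ->.
by move=> /andP[/stp xy /IHp yp] /yp; apply: connect_trans.
Qed.

Lemma contr_gt0 : (0 < #|contr_comp|)%N.
Proof. by apply/card_gt0P; exists (contr_proj w0). Qed.

Definition contraction : log_resolution n :=
  @LogResolution r n contr_comp contr_inter (fun a => genus (val a))
    (fun i => contr_proj (foot i)) contr_gt0 contr_interC contr_inter_ge0
    contr_connected contr_negdef.

Hypotheses (v0 : genus v = 0%N)
  (v1 : forall w, w != v -> inter v w <= 1)
  (v2 : \sum_(w | w != v) inter v w + #|[set i | foot i == v]|%:Z <= 2).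

Lemma contracts_to_contraction : contracts_to G contraction.
Proof.
exists v, val; split=> //; first split=> //.
- exact: val_inj.
- by move=> a; exact: contr_neq.
- by move=> w wv; exists (contr_proj w); rewrite contr_projK.
- move=> i /=; have [->|iv] := eqVneq (foot i : ecomp G) v.
    by rewrite contr_projv.
  by rewrite contr_projK.
Qed.

Hypotheses (G2 : (2 <= #|ecomp G|)%N) (Gorb : orbifold_log G).
(** A C_i meeting [v] moves to [w0], which must then become an end curve: this holds if [v] hangs on
    [w0] alone and [w0] has just one other neighbour. *)
Hypothesis vfoot : (forall i, foot i != v) \/
  ((forall w, w != v -> w != w0 -> inter v w = 0) /\ #|[set k | meets w0 k]| = 2%N).

Lemma feet_le1 (j : ecomp G) : (#|[set i | foot i == j]| <= 1)%N.
Proof.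
have := Gorb; rewrite /orbifold_log gtn_eqF // => -[end_foot end_le1].
have [->|/set0Pn[i]] := eqVneq [set i | foot i == j] set0; first by rewrite cards0.
by rewrite inE => /eqP ij; apply: end_le1; rewrite -ij.
Qed.

Lemma contr_meets (a b : ecomp contraction) : meets a b =
  (a != b) && (meets (val a) (val b) || (meets v (val a) && meets v (val b))).
Proof.
rewrite {1}/meets contr_meetsE /meets !(interC v) !(eq_sym v) !contr_neq /=.
by rewrite -val_eqE; case: eqP.
Qed.

Lemma contr_nbrs (a : ecomp contraction) : #|[set b | meets a b]| =
  #|([set k | meets (val a) k] :|:
     (if meets v (val a) then [set k | meets v k] else set0)) :\ v :\ val a|.
Proof.
rewrite -(card_imset _ val_inj); congr #|pred_of_set _|; apply/setP => k.
rewrite !inE; apply/imsetP/idP => [[b + ->]|/and3P[ka kv ak]].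
  rewrite inE contr_meets => /andP[ab H].
  rewrite contr_neq val_eqE eq_sym ab /=.
  by case/orP: H => [->//|/andP[-> ?]]; rewrite inE orbC /= ; apply/orP; left.
exists (contr_proj k); last by rewrite contr_projK.
rewrite inE contr_meets -val_eqE contr_projK // eq_sym ka /=.
case/orP: ak => [->//|]; case: ifP => [va|_]; rewrite inE // => vk.
by apply/orP; right; apply/andP.
Qed.

Lemma orbifold_log_contraction : orbifold_log contraction.
Proof.
have := Gorb; rewrite {1}/orbifold_log gtn_eqF // => -[end_foot _].
have cardC : #|ecomp contraction| = #|ecomp G|.-1.
  by rewrite card_sig cardC1.
rewrite /orbifold_log cardC; case: ifP => G3.
  (* Two curves become one, which may be met twice; each of the two brings at most one C_i. *)
  rewrite -sum1_card (partition_big (fun i => foot i : ecomp G) predT) //=.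
  have Gc : #|ecomp G| = 2%N by move/eqP: G3; lia.
  apply: (@leq_trans #|ecomp G|); last by rewrite Gc.
  rewrite -[leqRHS]sum1_card.
  apply: leq_sum => j _; rewrite sum1_card; apply: leq_trans (feet_le1 j).
  by rewrite subset_leq_card //; apply/subsetP => i; rewrite !inE.
have vNv : v \notin [set k | meets v k] by rewrite inE /meets eqxx.
have Nv2 : (#|[set k | meets v k]| <= 2)%N.
  by have := card_meets_le v; move: v2; lia.
split=> [i|a _].
  rewrite /end_curve contr_nbrs /=.
  have [iv|iv] := eqVneq (foot i : ecomp G) v.
    case: vfoot => [/(_ i)|[Nv Nw0]]; first by rewrite iv eqxx.
    have -> : [set k | meets v k] = [set w0].
      apply/setP => k; rewrite !inE /meets; have [->|kw] := eqVneq k w0.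
        by rewrite eq_sym w0v vw0.
      by have [<-|kv] := eqVneq v k; rewrite //= Nv // eq_sym.
    have mvw : meets v w0 by rewrite /meets eq_sym w0v vw0.
    rewrite iv contr_projv mvw.
    have vw : v \in [set k | meets w0 k].
      by rewrite inE /meets w0v interC vw0.
    have -> : ([set k | meets w0 k] :|: [set w0]) :\ v :\ w0 = [set k | meets w0 k] :\ v.
      apply/setP => k; rewrite !inE; case: (eqVneq k w0) => [->|_] /=.
        by rewrite {1}/meets eqxx andbF.
      by rewrite orbF.
    by move: Nw0; rewrite (cardsD1 v) vw add1n => -[->].
  rewrite contr_projK //; move: (foot i : ecomp G) (end_foot i) iv => e.
  rewrite /end_curve => /cards1P[z Ne] ev; rewrite Ne.
  have ez k : meets e k = (k == z) by move/setP/(_ k): Ne; rewrite !inE.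
  have ve : meets v e = (v == z) by rewrite -ez /meets eq_sym interC.
  rewrite ve; have [zv|zv] := eqVneq v z; last first.
    rewrite setU0 (_ : _ :\ _ = [set z]) ?cards1 //; apply/setP => k; rewrite !inE.
    have [->|//] := eqVneq k z; last by rewrite !andbF.
    rewrite andbT andbC eq_sym zv; have := ez z; rewrite eqxx.
    by case/andP; rewrite eq_sym.
  (* An end curve [e] hanging on [v] inherits the other neighbours of [v]: at most one, since [v]
     has at most two neighbours, and at least one, by connectedness, since [E] has at least three
     components. *)
  rewrite -zv (_ : _ :\ _ = [set k | meets v k] :\ e); last first.
    apply/setP => k; rewrite !inE; case: (k == e) => //=.
    by have [->|] := eqVneq k v; rewrite /meets ?eqxx.
  have eN : e \in [set k | meets v k] by rewrite inE ve zv eqxx.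
  move: Nv2; rewrite (cardsD1 e) eN !add1n ltnS => Nv1.
  rewrite eqn_leq Nv1 card_gt0; apply/set0Pn.
  have [||x [y [xS yS xy]]] := @connected_cut _ _ G [set e; v].
  - by apply/set0Pn; exists e; rewrite !inE eqxx.
  - apply: contraFN G3 => /eqP/setP E.
    by rewrite -(cardsT (ecomp G)) -(eq_card E) cards2 ev.
  move: xS yS; rewrite !inE negb_or => xS /andP[ye yv].
  case/orP: xS => /eqP xE; last by exists y; rewrite !inE ye -xE.
  by move: xy; rewrite xE ez -zv (negbTE yv).
have [av|av] := eqVneq (val a) w0; last first.
  apply: leq_trans (feet_le1 (val a)); apply: subset_leq_card.
  apply/subsetP => i; rewrite !inE /= => /eqP aE.
  have [iv|iv] := eqVneq (foot i : ecomp G) v.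
    by case/eqP: av; rewrite -aE iv contr_projv.
  by rewrite -aE contr_projK.
case: vfoot => [nv|[_ Nw0]].
  apply: leq_trans (feet_le1 (val a)); apply: subset_leq_card.
  apply/subsetP => i; rewrite !inE /= => /eqP aE.
  by rewrite -aE contr_projK ?nv //.
(* Having two neighbours, [w0] is not an end curve of [G], so every C_i now meeting it came from
   [v]. *)
apply: leq_trans (feet_le1 v); apply: subset_leq_card.
apply/subsetP => i; rewrite !inE /= => /eqP aE.
have [//|iv] := eqVneq (foot i : ecomp G) v.
have := end_foot i; rewrite /end_curve.
by rewrite -(contr_projK iv) aE av Nw0.
Qed.

End Contraction.

(** The only place where minimality itself enters; a single contraction step is always enough. *)
Lemma minimal_no_contraction (r : nat) (n : 'I_r -> nat) (G : log_resolution n)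
    (v w : ecomp G) :
  minimal_orbifold_log G -> (2 <= #|ecomp G|)%N ->
  genus v = 0%N -> inter v v = (-1)%R -> w != v -> inter v w = 1%R ->
  (forall k, k != v -> inter v k <= 1)%R ->
  (\sum_(k | k != v) inter v k + #|[set i | foot i == v]|%:Z <= 2)%R ->
  (forall i, foot i != v) \/
  ((forall k, k != v -> k != w -> inter v k = 0%R) /\
   #|[set k | meets w k]| = 2%N) -> False.
Proof.
move=> [Gorb Gmin] G2 v0 vv wv vw v1 v2 vfoot.
apply: (Gmin (contraction vv wv vw)); last exact: orbifold_log_contraction.
exact/Relation_Operators.t_step/contracts_to_contraction.
Qed.

(** * Branches, continuants and chains *)

Lemma ohead_notin (T : eqType) (b : seq T) w :
  w \notin b -> (ohead b == Some w) = false.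
Proof.
case: b => //= z b; rewrite inE negb_or (inj_eq Some_inj) eq_sym.
by case/andP=> /negbTE.
Qed.

(** Serves to read off all intersection numbers of a curve from its degree: the neighbours already
    known exhaust it. *)
Lemma sum_eq_ge (T : finType) (P : pred T) (g h : T -> int) :
  (forall k, P k -> h k <= g k)%R ->
  (\sum_(k | P k) g k <= \sum_(k | P k) h k)%R ->
  forall k, P k -> g k = h k.
Proof.
move=> hg gh k Pk; apply/eqP; rewrite -subr_eq0; apply/eqP.
apply: (@psumr_eq0P _ _ P (fun k => g k - h k)%R) => // [j Pj|].
  by rewrite subr_ge0 hg.
by apply/le_anti; rewrite sumrB subr_le0 gh subr_ge0 ler_sum.
Qed.

Section Branches.
Local Open Scope ring_scope.
Variables (T : finType) (f : T -> T -> int).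
Implicit Types (u y z j k : T) (b : seq T).

(* [b] is a string of curves emanating from [u], its first curve meeting [u],
   with no other intersections involving the curves of [b]. *)
Fixpoint branch u b : Prop :=
  if b is y :: b' then
    (forall k, k != y -> f y k = (k == u)%:R + (ohead b' == Some k)%:R)
    /\ branch y b'
  else True.

Lemma mem_chain_edges u b j k :
  (j, k) \in chain_edges (u :: b) -> j \in u :: b /\ k \in b.
Proof.
rewrite /chain_edges /=; elim: b u => [|y b IHb] u //=.
rewrite inE => /orP[/eqP[-> ->]|/IHb[jb kb]]; first by rewrite !inE !eqxx.
by rewrite inE jb orbT inE kb orbT.
Qed.

Lemma branch_chain_edges u b j k : uniq (u :: b) -> branch u b -> j \in b ->
  k != j -> f j k = (((j, k) \in chain_edges (u :: b)) ||
                     ((k, j) \in chain_edges (u :: b)) : nat)%:Z.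
Proof.
elim: b u => [|y b IHb] u //; rewrite [uniq _]/= => /andP[ub yb] [fy fb].
have -> : chain_edges [:: u, y & b] = (u, y) :: chain_edges (y :: b) by [].
rewrite [in X in X -> _]inE => jyb kj; rewrite !inE !xpair_eqE.
have jub : j != u by apply: contraNneq ub => <-; rewrite inE.
move: jyb; rewrite (negbTE jub) /=.
have [jy _|jy /= jb] := eqVneq j y; last first.
  by rewrite (IHb y) // andbF.
subst j.
have -> : ((k, y) \in chain_edges (y :: b)) = false.
  apply/negbTE; apply/negP => /mem_chain_edges[_]; apply/negP.
  by case/andP: yb.
rewrite andbT orbF fy //; case: b {IHb fb fy} ub yb => [|z b] ub yb.
  by rewrite addr0; case: (k == u).
rewrite inE xpair_eqE eqxx /= (inj_eq Some_inj).
have -> : ((y, k) \in chain_edges (z :: b)) = false.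
  apply/negbTE; apply/negP => /mem_chain_edges[+ _]; apply/negP.
  by case/andP: yb.
have uz : u != z by move: ub; rewrite !inE !negb_or => /and3P[].
rewrite orbF (eq_sym z); have [->|_] := eqVneq k z; last by case: (k == u).
by rewrite eq_sym (negbTE uz).
Qed.

Lemma branch_out u b j k : uniq (u :: b) -> branch u b -> j \in b ->
  k \notin b -> f j k = ((k == u) && (j == head u b))%:R.
Proof.
elim: b u => [//|y b IHb] u ub [yk br]; rewrite !inE negb_or => + /andP[ky kb].
have [uy yb] : u \notin y :: b /\ uniq (y :: b) by case/andP: ub.
case: eqVneq => [-> _|jy /= jb].
  rewrite yk // andbT; case: b kb {IHb ub uy yb yk br} => [|z b]; rewrite ?addr0 //=.
  rewrite inE negb_or (inj_eq Some_inj) eq_sym => /andP[/negbTE-> _].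
  by rewrite addr0.
by rewrite (IHb y) // (negbTE ky) andbF.
Qed.

Lemma sum_nbrs (R : pzRingType) (F : T -> R) u y b : y != u -> y \notin b ->
  \sum_(k | k != y) F k * ((k == u)%:R + (ohead b == Some k)%:R) =
  F u + oapp F 0 (ohead b).
Proof.
move=> yu yb; under eq_bigr do rewrite mulrDr; rewrite big_split /=; congr (_ + _).
  rewrite (bigD1 u) 1?eq_sym //= eqxx mulr1 big1 ?addr0 // => k /andP[_ ku].
  by rewrite (negbTE ku) mulr0.
case: b yb => [|z b] /=; first by move=> _; rewrite big1 // => k _; rewrite mulr0.
rewrite inE negb_or => /andP[yz _].
rewrite (bigD1 z) 1?eq_sym //= eqxx mulr1 big1 ?addr0 // => k /andP[_ kz].
by rewrite (inj_eq Some_inj) eq_sym (negbTE kz) mulr0.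
Qed.

Lemma nbr_sum y u b : y != u -> y \notin b ->
  (forall k, k != y -> f y k = (k == u)%:R + (ohead b == Some k)%:R) ->
  \sum_(k | k != y) f y k = (b != [::]).+1%:Z.
Proof.
move=> yu yb yk; rewrite (eq_bigr _ yk).
have /= := sum_nbrs (fun=> 1%:Z) yu yb; under eq_bigr do rewrite mul1r.
by move=> ->; case: b {yb yk}.
Qed.

Lemma branch_degree u b j : uniq (u :: b) -> branch u b -> j \in b ->
  \sum_(k | k != j) f j k = (j != last u b).+1%:Z.
Proof.
elim: b u => [//|y b IHb] u ub [yk br]; have [uy yb] := andP ub.
rewrite inE => /orP[/eqP->|jb] /=; last by rewrite (IHb y).
rewrite (nbr_sum _ _ yk).
- case: b yb {IHb ub uy yk br} => [|z b /andP[yzb _]] /=; first by rewrite eqxx.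
  suff -> : y != last z b by [].
  by apply: contraNneq yzb => ->; rewrite mem_last.
- by apply: contraNneq uy => ->; rewrite inE eqxx.
- by case/andP: yb.
Qed.

(* The continuant: the determinant of the negative of the intersection matrix
   of a chain with self-intersections [- s y]. *)
Fixpoint cont (s : T -> int) b : int :=
  if b is y :: b' then
    s y * cont s b' - (if b' is _ :: b'' then cont s b'' else 0)
  else 1.

(** With entries at least 2 the increments of the continuant do not decrease as curves are added in
    front, and the first one is at least 1. *)
Lemma cont_ge s b : all (fun y => 2 <= s y) b ->
  (size b)%:Z < cont s b /\ (b != [::] -> cont s (behead b) < cont s b).
Proof.
elim: b => [//|y [|z b] IHb]; first by rewrite /= => /andP[]; lia.
move=> /= /andP[y2] /IHb[] /=; set c := (X in _%:Z < X) => c1 /(_ isT) c2.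
split; nia.
Qed.

(** Expansion along the first row leaves two minors; the second has a single nonzero entry in its
    first column. This is the three-term recursion of [cont], the sign coming from the passage to
    the negative of the matrix. *)
Lemma tridiag_det x0 u b : (forall j k, f j k = f k j) -> uniq (u :: b) -> branch u b ->
  \det (\matrix_(i < size b, j < size b) f (nth x0 b i) (nth x0 b j)) =
  (-1) ^+ size b * cont (fun y => - f y y) b.
Proof.
move=> fC.
have [m] := ubnP (size b); elim: m u b => // m IHm u [|y [|z b]].
- by move=> *; rewrite det_mx00 mulr1.
- by move=> *; rewrite det_mx11 mxE /= expr1; ring.
rewrite ltnS => bm ub [fy [fz fb]].
pose M c := \matrix_(i < size c, j < size c) f (nth x0 c i) (nth x0 c j).
have ME c (i j : 'I_(size c)) : M c i j = f (nth x0 c i) (nth x0 c j) by rewrite mxE.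
have MS x c : row' ord0 (col' ord0 (M (x :: c))) = M c.
  by apply/matrixP => i j; rewrite !mxE.
change (\det (M [:: y, z & b]) = (-1) ^+ size [:: y, z & b] *
  cont (fun y => - f y y) [:: y, z & b]).
have [uy yz] : u \notin [:: y, z & b] /\ y \notin z :: b by case/and3P: ub.
have fz0 i : i \in b -> f y i = 0.
  move=> ib; rewrite fy; last first.
    by apply: contraNneq yz => <-; rewrite inE ib orbT.
  have /negbTE-> : i != u.
    by apply: contraNneq uy => <-; rewrite !inE ib !orbT.
  rewrite add0r (inj_eq Some_inj); have [zi|//] := eqVneq z i.
  by move: ub ib; rewrite zi => /= /and4P[_ _ /negbTE-> _].
have fyz : f y z = 1.
  rewrite fy; last by apply: contraNneq yz => <-; rewrite inE eqxx.
  rewrite eqxx; have [zu|_] := eqVneq z u; last by rewrite add0r.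
  by move: uy; rewrite -zu !inE eqxx orbT.
rewrite (expand_det_row _ ord0) !big_ord_recl big1 ?addr0 => [|i _]; last first.
  by rewrite !mxE /= fz0 ?mul0r //; apply/mem_nth/ltn_ord.
rewrite (ME [:: y, z & b] ord0 ord0).
rewrite (ME [:: y, z & b] ord0 (lift ord0 ord0)) /= fyz mul1r /cofactor.
rewrite (MS y (z :: b)).
set A := row' _ _; have -> : \det A = \det (M b).
  rewrite (expand_det_col _ ord0) big_ord_recl big1 ?addr0 => [|i _]; last first.
    by rewrite !mxE /= fC fz0 ?mul0r //; apply/mem_nth/ltn_ord.
  rewrite !mxE /= fC fyz mul1r /cofactor expr0 mul1r; congr (\det _).
  by apply/matrixP => i j; rewrite !mxE.
have [uz ub'] : uniq (z :: b) /\ uniq [:: y, z & b].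
  by case/and3P: ub => *; split=> //; apply/andP.
rewrite (IHm y (z :: b)) // (IHm z b) ?(ltnW bm) //.
by rewrite /= !exprS expr0; ring.
Qed.

End Branches.

Lemma eq_branch (T : finType) (f g : T -> T -> int) u b :
  f =2 g -> branch f u b -> branch g u b.
Proof.
move=> fg; elim: b u => [//|y b IHb] u /= [fy br].
by split; [move=> k ky; rewrite -fg fy | exact: IHb].
Qed.

(** The string grows at its front [z]. All intersections of the curves behind [z] are known, so by
    connectedness an edge to a new curve leaves from [z]. Starting from a curve of degree at most 1
    excludes a cycle. *)
Lemma chain_of_degrees (T : finType) (f : T -> T -> int) (U : {set T}) (x : T) :
  (forall j k, f j k = f k j) -> (forall j k, j != k -> 0 <= f j k)%R ->
  (forall S : {set T}, S \subset U -> S != set0 -> S != U ->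
     exists j k, [/\ j \in S, k \in U :\: S & f j k != 0%R]) ->
  (forall u, u \in U -> \sum_(k in U | k != u) f u k <= 2)%R ->
  x \in U -> (\sum_(k in U | k != x) f x k <= 1)%R ->
  exists z b, [/\ uniq (z :: b), z :: b =i U, last z b = x &
    branch (fun j k => if (j \in U) && (k \in U) then f j k else 0%R) z b].
Proof.
move=> fC f0 cut deg xU degx.
pose f' (j k : T) : int := if (j \in U) && (k \in U) then f j k else 0%R.
have f'C j k : f' j k = f' k j by rewrite /f' andbC fC.
have f'sum z : z \in U ->
    (\sum_(k | k != z) f' z k = \sum_(k in U | k != z) f z k)%R.
  move=> zU; rewrite [RHS]big_mkcondl; apply: eq_bigr => k _.
  by rewrite /f' zU.
suff grow m z b : (#|U| - size b <= m)%N -> uniq (z :: b) ->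
    {subset z :: b <= U} -> last z b = x -> branch f' z b ->
    exists z b, [/\ uniq (z :: b), z :: b =i U, last z b = x & branch f' z b].
  by apply: (grow #|U| x [::]) => //= [|j]; rewrite ?subn0 // inE => /eqP->.
elim: m z b => [|m IHm] z b bm zb sub lz br.
  have : (size (z :: b) <= #|U|)%N.
    by rewrite -(card_uniqP zb) subset_leq_card //; apply/subsetP.
  by move: bm; rewrite leqn0 subn_eq0 => Ub /leq_trans/(_ Ub); rewrite ltnn.
have [E|E] := eqVneq [set j in z :: b] U.
  by exists z, b; split=> // j; rewrite -E [RHS]inE.
have [||a [k [aS kS ak]]] := cut _ _ _ E.
- by apply/subsetP => j; rewrite inE => /sub.
- by apply/set0Pn; exists z; rewrite !inE eqxx.
move: aS kS; rewrite !inE negb_or => aS /andP[/andP[kz kb] kU].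
have zU : z \in U by apply: sub; rewrite inE eqxx.
have {aS} az : a = z.
  case/orP: aS => [/eqP//|ab]; have aU : a \in U by apply: sub; rewrite inE ab orbT.
  have := branch_out zb br ab kb; rewrite /f' aU kU (negbTE kz) /= => E0.
  by rewrite E0 eqxx in ak.
(* The new curve [k] and the next curve of the string use up the degree of [z], which is at most 2,
   and at most 1 while the string is just [x]. *)
have fk : forall l, l != z -> f' z l = ((l == k)%:R + (ohead b == Some l)%:R)%R.
  have znb : z \notin b by case/andP: zb.
  apply: sum_eq_ge => [l lz'|].
    have f'0 : (0 <= f' z l)%R.
      by rewrite /f'; case: ifP => // _; apply: f0; rewrite eq_sym.
    have [->|_] := eqVneq l k.
      rewrite ohead_notin // addr0 /f' zU kU.
      have := f0 z k; rewrite eq_sym kz => /(_ isT); move: ak; rewrite az /= mulr1n; lia.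
    rewrite add0r; case: (eqVneq (ohead b) (Some l)) => [bl|//].
    case: (b) bl zb br => // y b' [->] zb [yz _].
    rewrite f'C yz 1?eq_sym // eqxx; by case: (_ == _).
  rewrite f'sum //; have zk : z != k by rewrite eq_sym.
  have /= := sum_nbrs (fun=> 1%R : int) zk znb.
  under eq_bigr do rewrite mul1r; move=> ->.
  by case: (b) lz => [/= zx|y b' _ /=]; [rewrite zx addr0|exact: deg].
apply: (IHm k (z :: b)) => //.
- by move: bm; rewrite !leq_subLR addnS /= addSn.
- by rewrite cons_uniq inE negb_or kz kb.
- by move=> j; rewrite inE => /orP[/eqP->|/sub].
Qed.

(** * Adjunction and elimination along a string *)

Section Tails.
Local Open Scope ring_scope.
Variables (r : nat) (n : 'I_r -> nat) (G : log_resolution n).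
Implicit Types (u y z j k w : ecomp G) (b : seq (ecomp G)).
Implicit Types (X F : {ffun ecomp G -> rat}).

Definition neg_sq j : int := - inter j j.

Lemma neg_sq_ge1 j : 1 <= neg_sq j.
Proof. by rewrite /neg_sq; have := inter_lt0 j; lia. Qed.

Lemma dotE_split X j :
  dotE X j = - (neg_sq j)%:~R * X j + \sum_(k | k != j) X k * (inter j k)%:~R.
Proof.
rewrite /dotE (bigD1 j) //= /neg_sq rmorphN opprK mulrC; congr (_ + _).
by apply: eq_bigr => k _; rewrite interC.
Qed.

Lemma log_canon_dotE j : log_canon_dot j =
  (2 * genus j)%:R - 2 + (\sum_(k | k != j) inter j k)%:~R
  + \sum_(i : orb n | foot i == j) (1 - (n (val i))%:R^-1) :> rat.
Proof.
rewrite /log_canon_dot; congr (_ + _); rewrite (bigD1 j) //= /canon_dot !intrD.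
rewrite [in RHS]rmorph_sum /= !rmorphN /= -pmulrn.
under [in RHS]eq_bigr do rewrite interC.
by ring.
Qed.

Lemma nbr_card y u b : y != u -> y \notin b -> u \notin b ->
  (forall k, k != y -> inter y k = (k == u)%:R + (ohead b == Some k)%:R) ->
  #|[set k | meets y k]| = (b != [::]).+1.
Proof.
move=> yu yb ub yk; have -> : [set k | meets y k] = [set k in u :: take 1 b].
  have pq (p q : bool) : (p%:R + q%:R != 0 :> int) = p || q by case: p; case: q.
  apply/setP => k; rewrite !inE /meets eq_sym.
  have [->|ky] := eqVneq k y.
    rewrite (negbTE yu); case: b yb {ub yk} => //= z b.
    by rewrite take0 !inE negb_or => /andP[/negbTE-> _].
  rewrite yk // pq; congr (_ || _).
  case: b {yb ub yk} => [|z b] //=.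
  by rewrite take0 inE (inj_eq Some_inj) eq_sym.
rewrite cardsE; have /card_uniqP -> : uniq (u :: take 1 b).
  by case: b ub {yb yk} => //= z b; rewrite take0 !inE negb_or => /andP[->].
by case: b {ub yb yk} => //= z b; rewrite take0.
Qed.

Lemma branch_card u b j : uniq (u :: b) -> branch inter u b -> j \in b ->
  #|[set k | meets j k]| = (j != last u b).+1.
Proof.
elim: b u => [//|y b IHb] u ub [yk br]; have [uy yb] := andP ub.
rewrite inE => /orP[/eqP->|jb] /=; last by rewrite (IHb y).
rewrite (nbr_card _ _ _ yk).
- case: b yb {IHb ub uy yk br} => [|z b /andP[yzb _]] /=; first by rewrite eqxx.
  suff -> : y != last z b by [].
  by apply: contraNneq yzb => ->; rewrite mem_last.
- by apply: contraNneq uy => ->; rewrite inE eqxx.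
- by case/andP: yb.
- by apply: contra uy; rewrite inE orbC => ->.
Qed.

(* Elimination along a branch, from its far end. *)
Lemma branch_value X u y b (nu : rat) : uniq (u :: y :: b) ->
  branch inter u (y :: b) ->
  (forall j, j \in y :: b -> dotE X j = if j == last y b then - nu else 0) ->
  (cont neg_sq (y :: b))%:~R * X y = (cont neg_sq b)%:~R * X u + nu.
Proof.
elim: b u y => [|z b IHb] u y ub [yk br] Xj.
  have := Xj y (mem_head _ _); rewrite eqxx dotE_split.
  under eq_bigr => k ky do rewrite yk // rmorphD !rmorph_nat.
  rewrite (sum_nbrs X) ?addr0 //=; first by rewrite mulr1 subr0 mul1r; lra.
  by move: ub; rewrite /= !inE eq_sym => /andP[].
have [uy yz] : u \notin [:: y, z & b] /\ y \notin z :: b by case/and3P: ub.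
have -> : cont neg_sq [:: y, z & b] =
    neg_sq y * cont neg_sq (z :: b) - cont neg_sq b by [].
have {}IHb : (cont neg_sq (z :: b))%:~R * X z = (cont neg_sq b)%:~R * X y + nu.
  apply: IHb => // [|j jb]; first by case/andP: ub.
  by rewrite Xj // inE jb orbT.
move: (cont neg_sq (z :: b)) IHb => C IHb.
have := Xj y (mem_head _ _); rewrite dotE_split /=.
have -> : (y == last z b) = false.
  by apply: contraNF yz => /eqP->; rewrite mem_last.
under eq_bigr => k ky do rewrite yk // rmorphD !rmorph_nat.
rewrite (sum_nbrs X) //=; last first.
  by rewrite eq_sym; apply: contraNneq uy => ->; rewrite inE eqxx.
move=> Xy; have {Xy}Xz : X z = (neg_sq y)%:~R * X y - X u by lra.
by move: IHb; rewrite Xz intrB intrM; lra.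
Qed.

End Tails.
Arguments neg_sq {r n G} j.

(** * Peeling off the tails *)

Section Peeling.
Local Open Scope ring_scope.
Variables (r : nat) (n : 'I_r -> nat) (G : log_resolution n).
Implicit Types (u y z j k w : ecomp G) (b : seq (ecomp G)) (i : orb n).
Implicit Types (U S : {set ecomp G}) (B : ecomp G -> seq (seq (ecomp G))).

(* In a minimal resolution the only tails that contain a (-1)-curve are single
   (-1)-curves met by some C_i. *)
Definition good_tail b : Prop :=
  all (fun y => 2 <= neg_sq y) b \/
  exists y, [/\ b = [:: y], neg_sq y = 1 & (2 <= end_weight y)%N].

(** The last clause is adjunction: (K + E).E_j is -2 plus the degree of a rational E_j, so 0 inside
    the tail and -1 at its far end, where a C_i adds 1 - 1/n. *)
Definition tail u b : Prop :=
  [/\ b != [::], branch inter u b, good_tail b,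
      (forall j, j \in b -> genus j = 0%N) &
      (forall i, foot i \in b -> foot i = last u b) /\
      (forall j, j \in b -> log_canon_dot j =
         if j == last u b then - (end_weight j)%:R^-1 else 0)].

Lemma end_weight_gt0 j : (0 < end_weight j)%N.
Proof. by rewrite /end_weight; case: pickP => // i _; apply: ltnW (valP i). Qed.

Lemma unmet_end_weight j : end_weight j = 1%N -> unmet j.
Proof.
rewrite /end_weight; case: pickP => [i _ n1|no _ i].
  by have := valP i; rewrite n1.
by move/eqP; rewrite no.
Qed.

Lemma end_weight_unmet j : unmet j -> end_weight j = 1%N.
Proof.
by move=> no; rewrite /end_weight; case: pickP => // i /eqP ij; case: (no i).
Qed.

(* The number [n m] of the tail. *)
Definition tail_index u b : int := (end_weight (last u b))%:Z * cont neg_sq b.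

Lemma tail_cont u b : tail u b -> 1 <= cont neg_sq b.
Proof.
move=> [_ _ gb _ _]; case: gb => [/cont_ge[]|[y [-> /= -> _]]]; lia.
Qed.

(** Either the determinant exceeds the length of the tail, or the tail is a (-1)-curve of weight at
    least 2. *)
Lemma tail_index_ge2 u b : tail u b -> 2 <= tail_index u b.
Proof.
move=> [b0 _ gb _ _]; rewrite /tail_index.
case: gb b0 => [/cont_ge[b1 _]|[y [-> /= -> y2]] _]; last by lia.
have := end_weight_gt0 (last u b).
by case: b b1 => //= y b; set c := (X in _%:Z < X); nia.
Qed.

(** Without (-1)-curves the determinant exceeds the length, so index 2 forces length one and weight
    1; a (-1)-curve has determinant 1 and weight 2. *)
Lemma tail_index2 u b : (forall j, #|[set i | foot i == j]| <= 1)%N ->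
  tail u b -> tail_index u b = 2 -> exists2 x, b = [:: x] & half_tail x.
Proof.
move=> feet [b0 _ gb _ _]; rewrite /tail_index.
have ew := end_weight_gt0 (last u b).
case: gb b0 ew => [b2|[y [-> /= y1 y2]] _ _]; last first.
  rewrite y1 => ew; exists y => //; left; split; first by move: y1; rewrite /neg_sq; lia.
  move: ew y2 (feet y); rewrite /end_weight; case: pickP => // i /eqP iy ni _ fy.
  exists i; split=> [k|]; last by move: ni; rewrite subr0 !mulr1 => -[].
  split=> [ky|-> //]; move/card_le1P: fy => /(_ k); rewrite !inE ky eqxx => /(_ isT i).
  by rewrite !inE iy eqxx => /esym/eqP.
case: b b2 => [//|y [|z b]] b2 _ ew; last first.
  have [+ _] := cont_ge b2.
  by set c := cont _ _; set e := end_weight _ in ew *; move=> /= c3 e2; exfalso; nia.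
move: b2; rewrite /= andbT mulr1 subr0 => y2; rewrite /= in ew => e2.
have y2' : neg_sq y = 2 by nia.
exists y => //; right; split; first by move: y2'; rewrite /neg_sq; lia.
by apply: unmet_end_weight; nia.
Qed.

Lemma sum_count (R : nmodType) (F : ecomp G -> R) b :
  \sum_j F j *+ count_mem j b = \sum_(j <- b) F j.
Proof.
elim: b => [|y b IHb]; first by rewrite big_nil big1.
rewrite big_cons -IHb (bigD1 y) //= [in RHS](bigD1 y) //= eqxx mulrnDr addrA.
by congr (_ + _ + _); apply: eq_bigr => k /negbTE ky; rewrite eq_sym ky.
Qed.

(* [U] is what remains of [E] after removing the tails [B u] hanging from the
   curves [u] of [U]. *)
Definition peeled U B : Prop :=
  [/\ forall u b, u \in U -> b \in B u -> tail u b,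
      forall j, ((j \in U) + \sum_(u in U) count_mem j (flatten (B u)))%N = 1%N,
      U != set0 &
      forall S, S \subset U -> S != set0 -> S != U ->
        exists j k, [/\ j \in S, k \in U :\: S & meets j k]].

Section PeeledTheory.
Variables (U : {set ecomp G}) (B : ecomp G -> seq (seq (ecomp G))).
Hypothesis UB : peeled U B.

(** Writing the partition in [peeled] as total multiplicity 1 reduces this to an exchange of
    sums. *)
Lemma peeled_sum (R : nmodType) (F : ecomp G -> R) :
  \sum_j F j =
  \sum_(j in U) F j + \sum_(u in U) \sum_(b <- B u) \sum_(j <- b) F j.
Proof.
have [_ cnt _ _] := UB.
transitivity (\sum_j F j *+ ((j \in U) + \sum_(u in U) count_mem j (flatten (B u)))).
  by apply: eq_bigr => j _; rewrite cnt.
under eq_bigr do rewrite mulrnDr -sumrMnr; rewrite big_split exchange_big /=.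
congr (_ + _).
  by rewrite [RHS]big_mkcond; apply: eq_bigr => j _; case: (j \in U).
by apply: eq_bigr => u _; rewrite sum_count big_flatten.
Qed.

Lemma peeled_flatten u j : u \in U -> j \in flatten (B u) ->
  [/\ j \notin U, count_mem j (flatten (B u)) = 1%N &
      forall w, w \in U -> w != u -> j \notin flatten (B w)].
Proof.
have [_ cnt _ _] := UB; move=> uU.
have := cnt j; rewrite (bigD1 u) //= -has_pred1 has_count.
have arith (p : bool) (c s : nat) :
    (p + (c + s) = 1)%N -> (0 < c)%N -> [/\ ~~ p, c = 1%N & s = 0%N].
  by case: p => *; split; lia.
move=> /arith/[apply] [[jU c1 r0]]; split=> //.
move=> w wU wu; rewrite -has_pred1 has_count.
move/eqP: r0; rewrite sum_nat_eq0 => /forall_inP/(_ w).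
by rewrite wU wu => /(_ isT)/eqP->.
Qed.

Lemma peeled_uniq u : u \in U -> uniq (u :: flatten (B u)).
Proof.
move=> uU; rewrite /= ; apply/andP; split.
  by apply: contraL (uU) => /(peeled_flatten uU)[].
apply: count_mem_uniq => j; have [|/count_memPn->//] := boolP (j \in flatten (B u)).
by move=> /(peeled_flatten uU)[].
Qed.

Lemma mem_branch u b j : b \in B u -> j \in b -> j \in flatten (B u).
Proof. by move=> bB jb; apply/flattenP; exists b. Qed.

Lemma peeled_uniq1 u b : u \in U -> b \in B u -> uniq (u :: b).
Proof.
move=> /peeled_uniq + bB; case/splitPr: bB => s1 s2.
rewrite flatten_cat /= mem_cat mem_cat !negb_or !cat_uniq.
by case/andP=> /and3P[_ -> _] /and3P[_ _ /and3P[]].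
Qed.

Lemma peeled_cover j : j \notin U -> exists u b, [/\ u \in U, b \in B u & j \in b].
Proof.
have [_ cnt _ _] := UB; move=> /negbTE jU; have := cnt j; rewrite jU add0n.
move=> c1; have /existsP[u /andP[uU]] :
    [exists u, (u \in U) && (j \in flatten (B u))].
  apply: contra_eqT c1 => /existsPn no; rewrite big1 // => u uU.
  by apply/count_memPn; have := no u; rewrite uU.
by case/flattenP=> b bB jb; exists u, b.
Qed.

Lemma tail_out u b j k : u \in U -> b \in B u -> j \in b -> k \notin b ->
  inter j k = ((k == u) && (j == head u b))%:R.
Proof.
have [tl _ _ _] := UB => uU bB; apply: branch_out; first exact: peeled_uniq1.
by case: (tl u b uU bB).
Qed.

(** Outside the core, [u] meets only the first curves of its own tails, once each. With [F] constant
    this computes degrees, with [F] a divisor it computes [dotE]. *)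
Lemma peeled_nbr (R : pzRingType) (F : ecomp G -> R) u : u \in U ->
  \sum_(k | k != u) F k * (inter u k)%:~R =
  \sum_(k in U | k != u) F k * (inter u k)%:~R + \sum_(b <- B u) F (head u b).
Proof.
move=> uU; rewrite big_mkcond peeled_sum -big_mkcondr /=; congr (_ + _).
have [tl _ _ _] := UB.
rewrite (bigD1 u) //= [X in _ + X]big1 => [|w /andP[wU wu]]; last first.
  rewrite big_seq big1 // => b bB; rewrite big_seq big1 // => j jb.
  have ub : u \notin b.
    by apply: contraL (uU) => /(mem_branch bB)/(peeled_flatten wU)[].
  rewrite interC (tail_out wU bB jb ub) [u == w]eq_sym (negbTE wu) mulr0.
  by case: ifP.
rewrite addr0 big_seq [RHS]big_seq; apply: eq_bigr => b bB.
have := peeled_uniq1 uU bB; have [+ _ _ _ _] := tl u b uU bB.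
case: b bB => [//|y b] bB _ /= /and3P[uyb yb _].
have jn j : j \in y :: b -> j != u.
  by move=> jb; apply: contraNneq uyb => <-.
rewrite big_cons big_seq big1 => [|j jb]; last first.
  rewrite jn ?inE ?jb ?orbT // interC (tail_out uU bB) ?inE ?jb ?orbT //=.
  have [jy|_] := eqVneq j y; first by move: yb; rewrite -jy jb.
  by rewrite andbF mulr0.
rewrite jn ?mem_head // interC (tail_out uU bB) ?mem_head //= !eqxx.
by rewrite mulr1 addr0.
Qed.

Lemma end_weight_inv u : 0 < ((end_weight u)%:R^-1 : rat) <= 1.
Proof.
have e0 := end_weight_gt0 u.
by rewrite invr_gt0 ltr0n e0 invf_le1 ?ltr0n // ler1n.
Qed.

Lemma tail_index_inv u b : tail u b -> (tail_index u b)%:~R^-1 <= 2^-1 :> rat.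
Proof.
move=> /tail_index_ge2 i2; rewrite lef_pV2 ?posrE ?ltr0z //; last by lia.
by rewrite (ler_int _ 2).
Qed.

Lemma tail_index_sum u : u \in U ->
  \sum_(b <- B u) (tail_index u b)%:~R^-1 <= (size (B u))%:R / 2 :> rat.
Proof.
move=> uU; have [tl _ _ _] := UB.
have -> : (size (B u))%:R / 2 = \sum_(b <- B u) 2^-1 :> rat.
  by rewrite big_const_seq count_predT iter_addr_0 mulr_natl.
rewrite big_seq [leRHS]big_seq; apply: ler_sum => b bB.
exact/tail_index_inv/tl.
Qed.

Lemma tail_index_sum_eq u : u \in U ->
  (size (B u))%:R / 2 <= \sum_(b <- B u) (tail_index u b)%:~R^-1 :> rat ->
  forall b, b \in B u -> tail_index u b = 2.
Proof.
move=> uU sB b bB; have [tl _ _ _] := UB.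
have tb := tl u b uU bB; have i2 := tail_index_ge2 tb.
apply/eqP; case: eqP => // /eqP ib; exfalso; move: sB; apply/negP; rewrite -ltNge.
have -> : (size (B u))%:R / 2 = \sum_(b <- B u) 2^-1 :> rat.
  by rewrite big_const_seq count_predT iter_addr_0 mulr_natl.
rewrite !(big_rem b bB) /=; apply: ltr_leD.
  by rewrite ltf_pV2 ?posrE ?ltr0z //; [rewrite (ltr_int _ 2)|]; lia.
rewrite big_seq [leRHS]big_seq; apply: ler_sum => c /mem_rem cB.
exact/tail_index_inv/tl.
Qed.

End PeeledTheory.

End Peeling.

(** * Existence of a maximal peeling *)

Section MaximalPeeling.
Local Open Scope ring_scope.
Variables (r : nat) (n : 'I_r -> nat) (G : log_resolution n).
Hypotheses (Gmin : minimal_orbifold_log G) (G2 : (2 <= #|ecomp G|)%N).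
Implicit Types (u y z j k w : ecomp G) (b : seq (ecomp G)) (i : orb n).
Implicit Types (U S : {set ecomp G}) (B : ecomp G -> seq (seq (ecomp G))).

Lemma minimal_feet_le1 j : (#|[set i | foot i == j]| <= 1)%N.
Proof. by have [Gorb _] := Gmin; apply: feet_le1. Qed.

Lemma minimal_end_foot i : end_curve (foot i : ecomp G).
Proof. by have [+ _] := Gmin; rewrite /orbifold_log gtn_eqF // => -[]. Qed.

Lemma feet_sum j : \sum_(i : orb n | foot i == j) (1 - (n (val i))%:R^-1) =
  1 - (end_weight j)%:R^-1 :> rat.
Proof.
rewrite /end_weight; case: pickP => [i ij|no]; last first.
  by rewrite big_pred0 ?invr1 ?subrr.
rewrite (big_pred1 i) // => k /=; apply/idP/eqP => [kj|-> //].
have /card_le1P/(_ k) := minimal_feet_le1 j; rewrite !inE => /(_ kj i).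
by rewrite !inE (eqP ij) eqxx => /esym/eqP.
Qed.

Lemma peel_step U B u : peeled U B -> u \in U -> genus u = 0%N ->
  \sum_(k in U | k != u) inter u k = 1 -> (size (B u) <= 1)%N ->
  exists U' B', peeled U' B' /\ (#|U'| < #|U|)%N.
Proof.
move=> UB uU u0 deg1 szB; have [tl cnt _ cut] := UB.
pose b0 := head [::] (B u).
have Bb0 : flatten (B u) = b0.
  by rewrite /b0; case: (B u) szB => [|b [|? ?]] //= _; rewrite cats0.
have ub0 : uniq (u :: b0) by rewrite -Bb0; apply: (peeled_uniq UB).
have b0n : B u = [:: b0] \/ B u = [::] /\ b0 = [::].
  by rewrite /b0; case: (B u) szB => [|b [|? ?]] //= _; [right|left].
have tb0 : b0 = [::] \/ tail u b0.
  case: b0n => [E|[_ ->]]; [right; apply: tl => //; by rewrite E inE|by left].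
have br0 : branch inter u b0 by case: tb0 => [->|[]].
have valu : \sum_(k | k != u) inter u k = (b0 != [::]).+1%:Z.
  have /= := peeled_nbr UB (fun=> 1%:Z) uU.
  under eq_bigr do rewrite mul1r intz.
  under [in RHS]eq_bigr do rewrite mul1r intz.
  rewrite deg1 => ->; case: b0n => [E|[-> ->]]; last by rewrite big_nil addr0.
  rewrite E big_seq1; suff -> : b0 != [::] by [].
  by have [] : tail u b0 by apply: tl => //; rewrite E inE.
have [w wU uw] : exists2 w, w \in U & meets u w.
  apply/exists_inP; apply: contra_eqT deg1 => /exists_inPn no.
  rewrite big1 // => k /andP[kU ku].
  by have := no k kU; rewrite /meets eq_sym ku /= negbK => /eqP.
have [wu uw0] : w != u /\ inter u w != 0 by move: uw; rewrite /meets eq_sym => /andP.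
have uw' : u != w by rewrite eq_sym.
have uw1 : 1 <= inter u w.
  by have := @inter_ge0 _ _ G u w; rewrite eq_sym wu => /(_ isT); lia.
have wb0 : w \notin b0.
  by apply: contraL (wU) => wb; rewrite -Bb0 in wb; case: (peeled_flatten UB uU wb).
(* The degree of [u] equals the number of its known neighbours, [w] and the head of [b0]. *)
have uk : forall k, k != u -> inter u k = (k == w)%:R + (ohead b0 == Some k)%:R.
  apply: sum_eq_ge => [k ku|]; last first.
    rewrite valu; case/andP: ub0 => ub0 _.
    have /= := sum_nbrs (fun=> 1%:Z) uw' ub0.
    under eq_bigr do rewrite mul1r; move=> ->.
    by case: b0 {Bb0 b0n tb0 br0 valu wb0 ub0}.
  have [->|kw] := eqVneq k w.
    by rewrite ohead_notin // addr0.
  rewrite add0r; have [Ek|_] := eqVneq; last by rewrite inter_ge0 // eq_sym.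
  have : u \notin b0 /\ branch inter u b0 by case/andP: ub0.
  case: (b0) Ek ub0 => //= z b [->] /andP[ukb /andP[kb _]] [_ [Ez _]].
  rewrite interC Ez 1?eq_sym // eqxx.
  by case: (_ == _).
have cardu : #|[set k | meets u k]| = (b0 != [::]).+1.
  apply: (@nbr_card _ _ G u w b0) => //.
  by case/andP: ub0.
have unmet_u : b0 != [::] -> unmet u.
  move=> b0n0 i iu; have := minimal_end_foot i.
  by rewrite iu /end_curve cardu b0n0.
have lastu : (u == last u b0) = (b0 == [::]).
  case: (b0) ub0 => [|z b]; first by rewrite !eqxx.
  by move=> /andP[+ _] /=; apply: contraNF => /eqP->; rewrite mem_last.
have ucanon : log_canon_dot u =
    if u == last u b0 then - (end_weight u)%:R^-1 else 0.
  rewrite log_canon_dotE u0 valu feet_sum lastu; have [_|b0n0] := eqVneq b0 [::].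
    by rewrite /=; lra.
  rewrite (end_weight_unmet (unmet_u b0n0)) invr1 /=; lra.
have nocontr : neg_sq u = 1 -> ~ unmet u.
  move=> u1 uunmet; apply: (@minimal_no_contraction _ _ G u w Gmin G2 u0) => //.
  - by move: u1; rewrite /neg_sq; lia.
  - by rewrite uk // ohead_notin // eqxx.
  - move=> k ku; rewrite uk //; have [->|_] := eqVneq k w; last by case: (_ == _).
    by rewrite ohead_notin.
  - rewrite valu (_ : [set i | _] = set0) ?cards0; first by case: (b0).
    by apply/setP => i; rewrite !inE; apply/eqP/uunmet.
  - by left => i; apply/eqP/uunmet.
have goodu : good_tail (u :: b0).
  have [u1|u1] := eqVneq (neg_sq u) 1.
    (* By [nocontr] the (-1)-curve [u] is met by some C_i, hence is an end curve and has nothing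
       behind it. *)
    have b00 : b0 = [::].
      by apply/eqP/negP => /negP/unmet_u; apply: nocontr.
    right; exists u; rewrite b00; split=> //.
    rewrite ltn_neqAle end_weight_gt0 andbT; apply/negP => /eqP/esym e1.
    exact: (nocontr u1 (unmet_end_weight e1)).
  have u2 : 2 <= neg_sq u by have := neg_sq_ge1 u; lia.
  case: tb0 => [->|[_ _ gb g0 [fb _]]]; first by left; rewrite /= u2.
  case: gb => [gb|[y [by_ y1 y2]]]; first by left; rewrite /= u2.
  have yk : forall k, k != y -> inter y k = (k == u)%:R.
    by move=> k ky; move: br0; rewrite by_ => -[/(_ k ky) -> _]; rewrite addr0.
  have uy : u != y by move: ub0; rewrite by_ /= inE => /andP[].
  (* A tail consisting of a (-1)-curve [y] met by some C_i could be contracted: [u] has just the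
     neighbours [w] and [y], so it would become an end curve and take over the C_i. *)
  exfalso; apply: (@minimal_no_contraction _ _ G y u Gmin G2) => //.
  - by apply: g0; rewrite by_ inE.
  - by move: y1; rewrite /neg_sq; lia.
  - by rewrite yk // eqxx.
  - by move=> k ky; rewrite yk //; case: eqP.
  - have -> : \sum_(k | k != y) inter y k = 1.
      rewrite (bigD1 u) //= yk // eqxx big1 // => k /andP[ky ku].
      by rewrite yk // (negbTE ku).
    by have := minimal_feet_le1 y; lia.
  - right; split; last by rewrite cardu by_.
    by move=> k ky ku; rewrite yk // (negbTE ku).
have tailu : tail w (u :: b0).
  split=> //.
  - move=> j; rewrite inE => /orP[/eqP->//|jb].
    by case: tb0 jb => [->//|[_ _ _ g0 _]]; apply: g0.
  - split=> [i|j]; rewrite inE => /orP[/eqP E|E] /=.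
    + have : b0 = [::] \/ b0 != [::] by case: (b0); [left|right].
      by case=> [->//|/unmet_u/(_ i)/(_ E)].
    + by case: tb0 E => [->//|[_ _ _ _ [fb _]]]; apply: fb.
    + by rewrite E ucanon.
    + by case: tb0 E => [->//|[_ _ _ _ [_ lb]]]; apply: lb.
exists (U :\ u), (fun x => if x == w then (u :: b0) :: B w else B x); split; last first.
  by rewrite [leqRHS](cardsD1 u) uU.
split.
- move=> x b; rewrite !inE => /andP[xu xU]; case: eqP => [->|_]; last exact: tl.
  by rewrite inE => /orP[/eqP->//|]; apply: tl.
- move=> j; have := cnt j.
  rewrite (bigD1 u) //= (bigD1 w) /=; last by rewrite wU wu.
  rewrite [in X in _ -> X](bigD1 w) /=; last by rewrite !inE wU wu.
  rewrite eqxx Bb0 /= count_cat !inE.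
  rewrite [in X in _ -> X](eq_big (fun x => (x \in U) && (x != u) && (x != w))
     (fun x => count_mem j (flatten (B x)))) /=; last 2 first.
  + by move=> x; rewrite !inE [(x != u) && _]andbC.
  + by move=> x /andP[_ /negbTE->].
  have arith (p q : bool) (c d e : nat) : (p -> q) ->
      (q + (c + (d + e)) = 1 -> (~~ p && q) + (p + (c + d) + e) = 1)%N.
    by case: p; case: q => pq; move: (pq); lia.
  by rewrite [j == u]eq_sym; apply: arith => /eqP<-.
- by apply/set0Pn; exists w; rewrite !inE wu.
(* Removing the leaf [u] keeps the core connected: put [u] on the side of [w], its only core
   neighbour, and no edge of the cut ends at [u]. *)
- move=> S SU S0 SnU; have [wS|wS] := boolP (w \in S).
    have [|||j [k [jS kS jk]]] := cut (u |: S).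
    + apply/subsetP => x; rewrite !inE => /orP[/eqP->//|/(subsetP SU)].
      by rewrite !inE => /andP[].
    + by apply/set0Pn; exists u; rewrite !inE eqxx.
    + apply: contraNneq SnU => E; apply/eqP/setP => x; move/setP/(_ x): E.
      rewrite !inE; have [->|//] := eqVneq x u.
      by move=> _; apply/negP => /(subsetP SU); rewrite !inE eqxx.
    exists j, k; move: kS jS; rewrite !inE negb_or -andbA => /and3P[ku kS kU].
    rewrite ku kS kU; have [ju _|_ /= ->//] := eqVneq j u.
    move: jk; rewrite ju /meets uk // => /andP[_].
    have /negbTE-> : k != w by apply: contraNneq kS => ->.
    rewrite ohead_notin ?addr0 //.
    by apply: contraL kU => kb; rewrite -Bb0 in kb; case: (peeled_flatten UB uU kb).
  have [|//||j [k [jS kS jk]]] := cut S.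
  + by apply: subset_trans SU _; apply: subsetDl.
  + apply: contraNneq wS => ->; exact: wU.
  exists j, k; move: kS; rewrite jS !inE => /andP[kS kU]; rewrite kS kU /=.
  split=> //; rewrite andbT; apply: contraTneq jk => ->.
  have jU : (j \in U) && (j != u).
    by have := subsetP SU j jS; rewrite !inE andbC.
  case/andP: jU => jU ju; rewrite /meets interC uk // negb_and negbK.
  have /negbTE-> : j != w by apply: contraNneq wS => <-.
  rewrite ohead_notin ?addr0 ?eqxx ?orbT //.
  by apply: contraL jU => kb; rewrite -Bb0 in kb; case: (peeled_flatten UB uU kb).
Qed.

(** Starting from all of [E] without tails, every peeling step shrinks [U], so the process stops. *)
Lemma peel_max : exists U B, peeled U B /\
  forall u, u \in U -> genus u = 0%N -> \sum_(k in U | k != u) inter u k = 1 ->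
    (2 <= size (B u))%N.
Proof.
suff H m U B : peeled U B -> (#|U| < m)%N -> exists U B, peeled U B /\
  forall u, u \in U -> genus u = 0%N -> \sum_(k in U | k != u) inter u k = 1 ->
    (2 <= size (B u))%N.
  apply: (@H #|setT : {set ecomp G}|.+1 setT (fun=> [::])) => //; split=> //.
  - by move=> j; rewrite inE big1.
  - by rewrite -card_gt0 cardsT ltnW.
  - move=> S _ S0 ST; have [j [k [jS kS jk]]] := connected_cut S0 ST.
    by exists j, k; rewrite !inE kS.
elim: m U B => // m IHm U B UB Um.
have [/forall_inP done|] := boolP [forall (u | u \in U),
  (genus u == 0%N) && (\sum_(k in U | k != u) inter u k == 1) ==> (2 <= size (B u))%N].
  exists U, B; split=> // u uU u0 u1.
  by have := done u uU; rewrite u0 u1 !eqxx.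
case/forall_inPn => u uU; rewrite negb_imply -leqNgt => /andP[/andP[/eqP u0 /eqP u1] sz].
have [U' [B' [UB' lt]]] := peel_step UB uU u0 u1 sz.
by apply: IHm UB' _; apply: leq_trans lt Um.
Qed.

End MaximalPeeling.

(** * The consequence of zero volume *)

Section ZeroVolume.
Local Open Scope ring_scope.
Variables (r : nat) (n : 'I_r -> nat) (G : log_resolution n).
Hypotheses (Gmin : minimal_orbifold_log G) (G2 : (2 <= #|ecomp G|)%N).
Implicit Types (u y z j k w : ecomp G) (b : seq (ecomp G)) (i : orb n).
Variables (U : {set ecomp G}) (B : ecomp G -> seq (seq (ecomp G))).
Hypothesis UB : peeled U B.
Variable L : {ffun ecomp G -> rat}.
Hypotheses (LE : forall j, dotE L j = log_canon_dot j) (L0 : forall j, 0 <= L j).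

(** [T] is the divisor that [L] would be if it vanished on the core. Its intersection with a core
    curve is the sum of the 1/(nm), so the hypothesis is exactly what [effective_eq] needs to give
    [L = T]. *)
Lemma zero_volume_balance :
  (forall u, u \in U ->
    \sum_(b <- B u) (tail_index u b)%:~R^-1 <= log_canon_dot u) ->
  forall u, u \in U ->
    log_canon_dot u = \sum_(b <- B u) (tail_index u b)%:~R^-1 :> rat.
Proof.
have [tl _ _ _] := UB; move=> le_canon.
have [T [TU TE]] := dirichlet U (@log_canon_dot _ _ G).
have Tu u : u \in U -> dotE T u = \sum_(b <- B u) (tail_index u b)%:~R^-1.
  move=> uU; rewrite dotE_split TU // mulr0 add0r (peeled_nbr UB T uU).
  rewrite big1 ?add0r => [|k /andP[kU _]]; last by rewrite TU ?mul0r.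
  rewrite big_seq [RHS]big_seq; apply: eq_bigr => b bB.
  have tb := tl u b uU bB; have := tail_cont tb.
  have := peeled_uniq1 UB uU bB.
  have [+ br _ _ [_ cb]] := tb; have ew := end_weight_gt0 (last u b).
  have bU j : j \in b -> j \notin U.
    by move=> jb; case: (peeled_flatten UB uU (mem_branch bB jb)).
  rewrite /tail_index; case: b bB {tb} br cb bU ew => [//|y b] bB br cb bU ew _ ub c1.
  (* Since [T u = 0], elimination leaves m T_y = 1/n at the first curve [y] of the tail. *)
  have := @branch_value _ _ G T u y b (end_weight (last u (y :: b)))%:R^-1 ub br.
  rewrite (TU u uU) mulr0 add0r => Ey.
  rewrite intrM invfM mulrC -{}Ey ?mulKf //.
    by rewrite intr_eq0; move: c1; lia.
  move=> j jb; rewrite TE ?bU // cb //=.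
  by case: eqP => [->|].
suff LT : L = T by move=> u uU; rewrite -LE LT Tu.
apply: (effective_eq (U := U)) => // [j jU|j jU]; first by rewrite LE TE.
by rewrite Tu // LE le_canon.
Qed.

Lemma core_canon u : u \in U -> log_canon_dot u =
  (2 * genus u)%:R - 2 + (\sum_(k in U | k != u) inter u k)%:~R
  + (size (B u))%:R + (1 - (end_weight u)%:R^-1) :> rat.
Proof.
move=> uU; rewrite log_canon_dotE (feet_sum Gmin G2).
have := peeled_nbr UB (fun=> 1%:Z) uU.
under eq_bigr do rewrite mul1r intz.
under [in RHS]eq_bigr do rewrite mul1r intz.
move=> ->; rewrite big_const_seq count_predT iter_addr_0 intrD.
by rewrite rmorph_nat; ring.
Qed.

Hypothesis Bmax : forall u, u \in U -> genus u = 0%N ->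
  \sum_(k in U | k != u) inter u k = 1 -> (2 <= size (B u))%N.

Lemma core_degree_gt0 u : u \in U -> #|U| != 1%N ->
  1 <= \sum_(k in U | k != u) inter u k.
Proof.
have [_ _ _ cut] := UB; move=> uU U1.
have [|||j [k [+ + jk]]] := cut [set u].
- by rewrite sub1set.
- by apply/set0Pn; exists u; rewrite inE.
- by apply: contraNneq U1 => <-; rewrite cards1.
rewrite !inE => /eqP ju /andP[ku kU]; move: jk; rewrite ju => /andP[uk uk0].
rewrite (bigD1 k) /= ?kU // -[leLHS]addr0 lerD //.
  by have := inter_ge0 uk; move: uk0; lia.
by rewrite sumr_ge0 // => l /andP[/andP[_ lu] _]; rewrite inter_ge0 // eq_sym.
Qed.

(** With core degree d and s tails the reduced number is at least 2g - 2 + d + s/2. This is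
    nonnegative: d >= 1 by connectedness, and s >= 2 if g = 0 and d = 1. The balance then turns
    every estimate into an equality. *)
Lemma many_core u : u \in U -> #|U| != 1%N ->
  [/\ genus u = 0%N, unmet u &
    (\sum_(k in U | k != u) inter u k = 1 /\ size (B u) = 2%N /\
     forall b, b \in B u -> tail_index u b = 2) \/
    (\sum_(k in U | k != u) inter u k = 2 /\ B u = [::])].
Proof.
move=> + U1; have bal : forall u, u \in U ->
    log_canon_dot u = \sum_(b <- B u) (tail_index u b)%:~R^-1 :> rat.
  apply: zero_volume_balance => v vU; rewrite core_canon //.
  have /andP[_ e1] := end_weight_inv v; have := tail_index_sum UB vU.
  have := core_degree_gt0 vU U1; have := Bmax vU.
  set d := \sum_(k in U | _) _; set S := \sum_(b <- _) _ => Bm d1 S2.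
  have s0 : 0 <= (size (B v))%:R :> rat by rewrite ler0n.
  have d1' : 1 <= d%:~R :> rat by rewrite (ler_int _ 1).
  have [g0|g0] := posnP (genus v); last first.
    have : 2 <= (2 * genus v)%:R :> rat by rewrite (ler_nat _ 2); lia.
    lra.
  rewrite g0 muln0; have [d0|d0] := eqVneq d 1.
    have : 2 <= (size (B v))%:R :> rat by rewrite (ler_nat _ 2) Bm.
    lra.
  have : 2 <= d%:~R :> rat by rewrite (ler_int _ 2); lia.
  lra.
move=> uU; have := bal u uU; rewrite core_canon //.
have ew := end_weight_inv u; have S2 := tail_index_sum UB uU.
have Seq := tail_index_sum_eq UB uU; move: S2 Seq.
have := core_degree_gt0 uU U1; have := Bmax uU.
set d := \sum_(k in U | _) _; set S := \sum_(b <- _) _ => Bm d1 S2 Seq E.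
have s0 : 0 <= (size (B u))%:R :> rat by rewrite ler0n.
have d1' : 1 <= d%:~R :> rat by rewrite (ler_int _ 1).
have g0 : genus u = 0%N.
  apply/eqP; rewrite -leqn0 leqNgt; apply/negP => g1.
  have : 2 <= (2 * genus u)%:R :> rat by rewrite (ler_nat _ 2); lia.
  by case/andP: ew; lra.
rewrite g0 muln0 in E; have ew1 : (end_weight u)%:R^-1 = 1 :> rat ->
    unmet u.
  move=> /eqP; rewrite invr_eq1 pnatr_eq1 => /eqP.
  exact: unmet_end_weight.
have [d2|d2] := eqVneq d 1.
  have sz := Bm g0 d2; have sz2 : 2 <= (size (B u))%:R :> rat by rewrite (ler_nat _ 2).
  rewrite d2 in E; split=> //; first by apply: ew1; case/andP: ew; lra.
  left; split=> //; split; last by apply: Seq; case/andP: ew; lra.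
  apply/eqP; rewrite eqn_leq sz andbT -(ler_nat rat); case/andP: ew; lra.
have dd : 2 <= d%:~R :> rat by rewrite (ler_int _ 2); lia.
split=> //; first by apply: ew1; case/andP: ew; lra.
right; split.
  apply/eqP; rewrite -(eqr_int rat); apply/eqP; case/andP: ew; lra.
apply/size0nil/eqP; rewrite -leqn0 -(ler_nat rat); case/andP: ew; lra.
Qed.

(** A positive reduced number would satisfy the hypothesis of [zero_volume_balance] and so be 0. If
    g >= 1, the s tails would give s <= s/2, impossible for s > 0. *)
Lemma single_core u : U = [set u] -> (0 < size (B u))%N ->
  genus u = 0%N /\
  (size (B u))%:R - 2 + (1 - (end_weight u)%:R^-1) <=
    \sum_(b <- B u) (tail_index u b)%:~R^-1 :> rat.
Proof.
move=> Uu Bu; have uU : u \in U by rewrite Uu inE.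
have canonE : log_canon_dot u = (2 * genus u)%:R - 2 + (size (B u))%:R
    + (1 - (end_weight u)%:R^-1) :> rat.
  rewrite core_canon // big1 ?addr0 // => k; rewrite Uu inE.
  by case/andP=> ->.
have le_canon : log_canon_dot u <= \sum_(b <- B u) (tail_index u b)%:~R^-1 :> rat.
  rewrite leNgt; apply/negP => lt; have : log_canon_dot u = 
      \sum_(b <- B u) (tail_index u b)%:~R^-1 :> rat.
    apply: (zero_volume_balance _ uU) => v; rewrite Uu inE => /eqP->.
    exact: ltW.
  by move=> E; rewrite E ltxx in lt.
have := tail_index_sum UB uU; have /andP[_ e1] := end_weight_inv u.
move: le_canon; rewrite canonE; set S := \sum_(b <- _) _ => le1 S2.
have s1 : 1 <= (size (B u))%:R :> rat by rewrite ler1n.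
have g0 : genus u = 0%N.
  apply/eqP; rewrite -leqn0 leqNgt; apply/negP => g1.
  have : 2 <= (2 * genus u)%:R :> rat by rewrite (ler_nat _ 2); lia.
  lra.
by split=> //; move: le1; rewrite g0 muln0; lra.
Qed.

End ZeroVolume.

(** * Shapes of the graph *)

Lemma uniq_flatten_inj (T : eqType) (ss : seq (seq T)) b c j :
  uniq (flatten ss) -> b \in ss -> c \in ss -> j \in b -> j \in c -> b = c.
Proof.
elim: ss => //= s ss IHss; rewrite cat_uniq => /and3P[_ /hasPn sN uss].
rewrite !inE => /orP[/eqP->|bss] /orP[/eqP->|css] jb jc //.
- by have := sN j; rewrite jb => /(_ (introT flattenP (ex_intro2 _ _ c css jc))).
- by have := sN j; rewrite jc => /(_ (introT flattenP (ex_intro2 _ _ b bss jb))).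
- exact: IHss.
Qed.

(** This is 1/p + 1/q + 1/s >= 1 without denominators. Then 3/p >= 1, and for p = 2 either q = 2 or
    2/q >= 1/2. *)
Lemma volume_zero_triple_of_sum (p q s : nat) : (2 <= p <= q)%N -> (q <= s)%N ->
  (p * q * s <= q * s + p * s + p * q)%N -> volume_zero_triple p q s.
Proof.
move=> /andP[p2 pq] qs H; have p3 : (p <= 3)%N by nia.
have [pE|pE] : p = 2%N \/ p = 3%N by lia.
  have [qE|qE] : q = 2%N \/ (3 <= q)%N by lia.
    by apply: Or41; split; lia.
  have q4 : (q <= 4)%N by nia.
  have [qE'|qE'] : q = 3%N \/ q = 4%N by lia.
    by apply: Or42; subst; split=> //; apply/andP; split; lia.
  by apply: Or43; subst; split=> //; lia.
have qE : q = 3%N by nia.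
by apply: Or44; subst; split=> //; lia.
Qed.

Section Shapes.
Local Open Scope ring_scope.
Variables (r : nat) (n : 'I_r -> nat) (G : log_resolution n).
Implicit Types (u x y z j k w : ecomp G) (b : seq (ecomp G)) (i : orb n).

Variables (U : {set ecomp G}) (B : ecomp G -> seq (seq (ecomp G))).
Hypothesis UB : peeled U B.

Lemma tail_edges u b j k : u \in U -> b \in B u -> j \in b -> k != j ->
  inter j k = (((j, k) \in chain_edges (u :: b)) ||
               ((k, j) \in chain_edges (u :: b)) : nat)%:Z.
Proof.
move=> uU bB; apply: branch_chain_edges; first exact: (peeled_uniq1 UB).
by have [tl _ _ _] := UB; case: (tl u b uU bB).
Qed.

(** Any order of the tails is allowed because the three-branch case sorts them by nm. *)
Lemma star_of_peeled u bs : U = [set u] -> perm_eq bs (B u) -> is_star u bs.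
Proof.
move=> Uu pB; have uU : u \in U by rewrite Uu inE.
have [tl _ _ _] := UB; have bB b : b \in bs -> b \in B u by rewrite (perm_mem pB).
have [ufl flu] : u \notin flatten bs /\ uniq (flatten bs).
  rewrite (perm_mem (perm_flatten pB)) (perm_uniq (perm_flatten pB)).
  exact/andP/(peeled_uniq UB).
have cover j : j != u -> exists2 b, b \in bs & j \in b.
  move=> ju; have [|v [b [vU bv jb]]] := peeled_cover UB (j := j).
    by rewrite Uu inE.
  exists b => //; rewrite (perm_mem pB).
  by move: vU; rewrite Uu inE => /eqP <-.
have ub b : b \in bs -> u \notin b.
  by move=> bbs; apply: contra ufl => ub; apply/flattenP; exists b.
have edge b j k : b \in bs -> j \in b ->
    ((j, k) \in flatten [seq chain_edges (u :: b) | b <- bs]) =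
      ((j, k) \in chain_edges (u :: b)) /\
    ((k, j) \in flatten [seq chain_edges (u :: b) | b <- bs]) =
      ((k, j) \in chain_edges (u :: b)).
  move=> bbs jb; split; apply/flatten_mapP/idP; try by exists b.
    move=> [c cbs jk]; have [jc _] := mem_chain_edges jk.
    rewrite (uniq_flatten_inj flu bbs cbs jb) //; move: jc; rewrite inE.
    by case: eqP => // ju; move: (ub b bbs); rewrite -ju jb.
  move=> [c cbs jk]; have [_ jc] := mem_chain_edges jk.
  by rewrite (uniq_flatten_inj flu bbs cbs jb).
split.
  by apply/allP => b /bB bBu; case: (tl u b uU bBu).
split.
- by rewrite /= ufl flu.
- move=> j; rewrite inE; have [//|/cover[b bbs jb]] := eqVneq j u.
  by apply/flattenP; exists b.
- move=> j k jk; have [ju|/cover[b bbs jb]] := eqVneq j u.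
    have [|b bbs kb] := cover k; first by rewrite -ju eq_sym.
    have [-> ->] := edge b k j bbs kb.
    by rewrite interC (tail_edges uU (bB b bbs) kb) // orbC.
  have [-> ->] := edge b j k bbs jb.
  by rewrite (tail_edges uU (bB b bbs) jb) // eq_sym.
Qed.

Lemma tail_indexE u b : u \in U -> b \in B u ->
  ((branch_weight u b * branch_det b)%N)%:Z = tail_index u b.
Proof.
move=> uU bB; have [tl _ _ _] := UB; have tb := tl u b uU bB.
rewrite /tail_index PoszM; congr (_ * _); rewrite /branch_det.
have -> : \matrix_(i < size b, j < size b)
     inter (tnth (in_tuple b) i) (tnth (in_tuple b) j) =
   \matrix_(i < size b, j < size b) inter (nth u b i) (nth u b j).
  by apply/matrixP => i j; rewrite !mxE !(tnth_nth u).
have [_ br _ _ _] := tb.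
rewrite (tridiag_det _ (@interC _ _ G) (peeled_uniq1 UB uU bB) br).
by rewrite abszMsign gez0_abs //; have := tail_cont tb; rewrite -/neg_sq; lia.
Qed.

Lemma foot_last u i : U = [set u] -> unmet u ->
  exists2 b, b \in B u & foot i = last u b.
Proof.
move=> Uu nou; have [|v [b [vU bv ib]]] := peeled_cover UB (j := foot i).
  by rewrite Uu inE; apply/eqP/nou.
move: vU bv; rewrite Uu inE => /eqP-> bB; exists b => //.
have [tl _ _ _] := UB; have uU : u \in U by rewrite Uu inE.
by have [_ _ _ _ [+ _]] := tl u b uU bB; apply.
Qed.

Lemma all_rational_peeled : (forall u, u \in U -> genus u = 0%N) -> all_rational G.
Proof.
move=> g0 j; have [/g0//|/(peeled_cover UB)[u [b [uU bB jb]]]] := boolP (j \in U).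
by have [tl _ _ _] := UB; have [_ _ _ + _] := tl u b uU bB; apply.
Qed.

Hypotheses (Gmin : minimal_orbifold_log G) (G2 : (2 <= #|ecomp G|)%N).

(** A met curve is an end curve with one neighbour, but two tails have distinct first curves. *)
Lemma unmet_center u : u \in U -> (2 <= size (B u))%N -> unmet u.
Proof.
move=> uU sz i iu; have [tl _ _ _] := UB.
have := minimal_end_foot Gmin G2 i; rewrite iu /end_curve => /cards1P[z Nz].
have := peeled_uniq UB uU.
have hd b : b \in B u -> head u b = z.
  move=> bB; have [b0 br _ _ _] := tl u b uU bB; have := peeled_uniq1 UB uU bB.
  move: br b0; case: b bB => //= y b _ [yk _] _; rewrite inE negb_or.
  case/andP=> /andP[uy _] _; suff : y \in [set k | meets u k] by rewrite Nz inE => /eqP.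
  rewrite inE /meets uy interC yk // eqxx.
  by case: (ohead b == Some u).
case: (B u) sz hd (fun b => tl u b uU) => [//|b1 [//|b2 bs]] _ hd {}tl.
have h1 := hd b1 (mem_head _ _); have [b10 _ _ _ _] := tl b1 (mem_head _ _).
have b2m : b2 \in [:: b1, b2 & bs] by rewrite !inE eqxx orbT.
have h2 := hd b2 b2m; have [b20 _ _ _ _] := tl b2 b2m.
case: b1 h1 b10 {hd tl b2m} => //= y1 b1 -> _.
case: b2 h2 b20 => //= y2 b2 -> _.
by case/and3P=> _; rewrite mem_cat inE eqxx orbT.
Qed.

(** Only the ends of a chain are end curves, and each is met by at most one C_i; hence the position
    of a C_i determines it. *)
Lemma chain_case_of_degrees x :
  (forall j, \sum_(k | k != j) inter j k <= 2) ->
  \sum_(k | k != x) inter x k <= 1 -> chain_case G.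
Proof.
move=> deg degx.
have setTE j : \sum_(k in [set: ecomp G] | k != j) inter j k =
    \sum_(k | k != j) inter j k.
  by apply: eq_bigl => k; rewrite inE.
have [|||||z [b [zb zbT _ br]]] :=
    @chain_of_degrees _ (@inter _ _ G) [set: ecomp G] x (@interC _ _ G).
- exact: inter_ge0.
- move=> S _ S0 ST; have [j [k [jS kS /andP[_ jk]]]] := connected_cut S0 ST.
  by exists j, k; rewrite !inE kS.
- by move=> u _; rewrite setTE.
- by rewrite inE.
- by rewrite setTE.
have {}br : branch inter z b.
  by apply: eq_branch br => j k; rewrite !inE.
have {}zbT j : j \in z :: b by rewrite zbT inE.
have ends i : foot i \in [:: z; last z b].
  have := minimal_end_foot Gmin G2 i; rewrite /end_curve; have := zbT (foot i).
  rewrite inE => /orP[/eqP->|fb]; first by rewrite !inE eqxx.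
  by rewrite (branch_card zb br fb) !inE eqSS eqb0 negbK => ->; rewrite orbT.
exists z, b, (fun i => foot i == last z b); split.
- split=> // j k jk; have := zbT j; rewrite inE => /orP[/eqP jz|jb].
    have kb : k \in b.
      by have := zbT k; rewrite inE -jz eq_sym (negbTE jk).
    by rewrite interC (branch_chain_edges zb br kb jk) orbC.
  by rewrite (branch_chain_edges zb br jb) // eq_sym.
- move=> i i' ii'; have ff : foot i = foot i' :> ecomp G.
    have := ends i; have := ends i'; rewrite /= in ii'; rewrite !inE -ii'.
    have [lz|_] := eqVneq (foot i) (last z b).
      by move=> _ _; rewrite lz; apply/esym/eqP; rewrite -ii' lz.
    by rewrite !orbF => /eqP-> /eqP.
  have /card_le1P/(_ i) := minimal_feet_le1 Gmin G2 (foot i).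
  by rewrite !inE eqxx => /(_ isT i'); rewrite !inE ff eqxx => /esym/eqP.
- move=> i; have := ends i; rewrite !inE.
  by have [->|_] := eqVneq (foot i) (last z b); rewrite ?orbF // => /eqP.
Qed.

End Shapes.

Lemma inv_sum3_ge1 (p q s : nat) : (0 < p)%N -> (0 < q)%N -> (0 < s)%N ->
  (1 <= p%:R^-1 + q%:R^-1 + s%:R^-1 :> rat)%R ->
  (p * q * s <= q * s + p * s + p * q)%N.
Proof.
move=> p0 q0 s0 H; rewrite -(ler_nat rat) !natrD !natrM.
have -> : (q%:R * s%:R + p%:R * s%:R + p%:R * q%:R =
    (p%:R^-1 + q%:R^-1 + s%:R^-1) * (p%:R * q%:R * s%:R) :> rat)%R.
  by field; rewrite !pnatr_eq0 -!lt0n p0 q0 s0.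
by rewrite ler_peMl // !mulr_ge0.
Qed.

(** * Several core curves *)

Section Classification.
Local Open Scope ring_scope.
Variables (r : nat) (n : 'I_r -> nat) (G : log_resolution n).
Hypotheses (Gmin : minimal_orbifold_log G) (G2 : (2 <= #|ecomp G|)%N).
Implicit Types (u x y z j k w : ecomp G) (b : seq (ecomp G)) (i : orb n).
Variables (U : {set ecomp G}) (B : ecomp G -> seq (seq (ecomp G))).
Hypothesis UB : peeled U B.

Lemma half_tails u b : u \in U -> b \in B u -> tail_index u b = 2 ->
  exists2 x, b = [:: x] & half_tail x.
Proof.
have [tl _ _ _] := UB => uU bB; apply: tail_index2; last exact: tl.
exact: minimal_feet_le1.
Qed.

Lemma inter_tail1 u x k : u \in U -> [:: x] \in B u -> k != x ->
  inter x k = (k == u)%:R.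
Proof.
have [tl _ _ _] := UB => uU xB kx; have [_ [xk _] _ _ _] := tl u _ uU xB.
by rewrite xk // addr0.
Qed.

(** The core is a chain whose inner curves have degree 2 and no tails, while its two ends carry two
    tails of index 2 each. *)
Lemma two_node_of_peeled (i0 : orb n) : #|U| != 1%N ->
  (forall u, u \in U -> [/\ genus u = 0%N, unmet u &
    (\sum_(k in U | k != u) inter u k = 1 /\ size (B u) = 2%N /\
     forall b, b \in B u -> tail_index u b = 2) \/
    (\sum_(k in U | k != u) inter u k = 2 /\ B u = [::])]) ->
  two_node_case G.
Proof.
move=> U1 core; have [tl _ _ cut] := UB.
have tails2 u : u \in U -> \sum_(k in U | k != u) inter u k = 1 ->
    exists a1 a2, [/\ B u = [:: [:: a1]; [:: a2]], half_tail a1, half_tail a2,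
      a1 != a2 & a1 \notin U /\ a2 \notin U].
  move=> uU d1; have [_ _ [[_ [sz idx]]|[d2 _]]] := core u uU; last by rewrite d2 in d1.
  have := peeled_flatten UB uU; have := peeled_uniq UB uU.
  have := half_tails uU; case: (B u) sz idx => [//|c1 [//|c2 []]] // _ idx half.
  have c1B : c1 \in [:: c1; c2] by rewrite inE eqxx.
  have c2B : c2 \in [:: c1; c2] by rewrite !inE eqxx orbT.
  have [a1 E1 h1] := half c1 c1B (idx c1 c1B).
  have [a2 E2 h2] := half c2 c2B (idx c2 c2B).
  rewrite {}E1 {}E2 /= !inE => /and3P[_ a12 _] nU; exists a1, a2; split=> //.
  by split; [case: (nU a1)|case: (nU a2)] => //; rewrite !inE eqxx ?orbT.
(* Core curves are unmet, so the curve C_i of index [i0] lies on a tail; the core curve [u0]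
   carrying it has core degree 1, and the core is not a cycle. *)
have i0U : foot i0 \notin U.
  by apply/negP => fU; have [_ nou _] := core _ fU; apply: (nou i0).
have [u0 [b0 [u0U b0B _]]] := peeled_cover UB i0U.
have d0 : \sum_(k in U | k != u0) inter u0 k = 1.
  by have [_ _ [[]//|[_ B0]]] := core u0 u0U; rewrite B0 in b0B.
pose f' j k : int := if (j \in U) && (k \in U) then inter j k else 0.
have [|||||z [b [zb zbU lz br]]] :=
    @chain_of_degrees _ (@inter _ _ G) U u0 (@interC _ _ G).
- exact: inter_ge0.
- move=> S SU S0 SnU; have [j [k [jS kS /andP[_ jk]]]] := cut S SU S0 SnU.
  by exists j, k.
- by move=> u uU; have [_ _ [[-> _]|[-> _]]] := core u uU.
- exact: u0U.
- by rewrite d0.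
rewrite -/f' in br; have f'C j k : f' j k = f' k j.
  by rewrite /f' andbC interC.
have f'E j k : j \in U -> k \in U -> inter j k = f' j k.
  by rewrite /f' => -> ->.
have f'sum u : u \in U ->
    \sum_(k in U | k != u) inter u k = \sum_(k | k != u) f' u k.
  move=> uU; rewrite big_mkcondl; apply: eq_bigr => k _.
  by rewrite /f' uU.
have zU : z \in U by rewrite -zbU inE eqxx.
have bU j : j \in b -> j \in U by move=> jb; rewrite -zbU inE jb orbT.
have bn0 : b != [::].
  apply: contraNneq U1 => b0'; apply/eqP.
  by rewrite -(eq_card zbU) (card_uniqP zb) b0'.
(* [branch] does not describe the front [z]; symmetry and the curves behind it leave [z] only the
   first curve of [b] as core neighbour. *)
have dz : \sum_(k in U | k != z) inter z k = 1.
  case: (b) bn0 zb zbU br bU => // y b' _ zb zbU br bU.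
  have yU : y \in U by apply: bU; rewrite inE eqxx.
  have yz : y != z by move: zb; rewrite /= inE negb_or eq_sym -!andbA => /and3P[].
  have znb : z \notin y :: b' by case/andP: zb.
  rewrite (bigD1 y) ?yU //= big1 ?addr0 => [|k /andP[/andP[kU kz] ky]].
    rewrite f'E // f'C (branch_out zb br) ?mem_head // !eqxx. by [].
  rewrite f'E // f'C (branch_out zb br) // ?(negbTE ky) ?andbF //.
  by move: kU; rewrite -zbU inE (negbTE kz).
have midB u : u \in b -> u != last z b -> B u = [::].
  move=> ub ul; have uU := bU u ub; have [_ _ [[d1 _]|[_ ->//]]] := core u uU.
  by move: d1; rewrite f'sum // (branch_degree zb br ub) ul.
have [a1 [a2 [Bz ha1 ha2 a12 [a1U a2U]]]] := tails2 z zU dz.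
have [b1 [b2 [Bl hb1 hb2 b12 [b1U b2U]]]] := tails2 u0 u0U d0.
have zu0 : z != u0.
  rewrite -lz; case: (b) bn0 zb => //= y b' _ /andP[+ _].
  by apply: contraNneq => ->; rewrite mem_last.
have cover j : j \notin U -> j \in [:: a1; a2; b1; b2].
  move=> /(peeled_cover UB)[u [c [uU cB jc]]].
  have : u \in z :: b by rewrite zbU.
  rewrite inE; have [uz _|uz /= ub] := eqVneq u z.
    move: cB; rewrite uz Bz !inE => /orP[]/eqP cE; move: jc;
    by rewrite cE inE => ->; rewrite ?orbT.
  have [ul|ul] := eqVneq u u0; last by rewrite midB ?lz // in cB.
  move: cB; rewrite ul Bl !inE => /orP[]/eqP cE; move: jc;
  by rewrite cE inE => ->; rewrite ?orbT.
have a1B : [:: a1] \in B z by rewrite Bz inE eqxx.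
have a2B : [:: a2] \in B z by rewrite Bz !inE eqxx orbT.
have b1B : [:: b1] \in B u0 by rewrite Bl inE eqxx.
have b2B : [:: b2] \in B u0 by rewrite Bl !inE eqxx orbT.
have ab a c : [:: a] \in B z -> [:: c] \in B u0 -> a != c.
  move=> aB cB; have aF : a \in flatten (B z) by rewrite (mem_branch aB) ?inE.
  have [_ _ /(_ u0 u0U)] := peeled_flatten UB zU aF.
  rewrite eq_sym zu0 => /(_ isT); apply: contraNneq => ->.
  by rewrite (mem_branch cB) ?inE.
have nU t : t \notin U -> t \notin z :: b by rewrite zbU.
have neqU t v : t \notin U -> v \in U -> (v == t) = false.
  by move=> tU vU; apply: contraNF tU => /eqP <-.
case: (lastP b) bn0 zb zbU lz br bU dz midB nU => // F Fk _ zb zbU.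
rewrite last_rcons => lz br bU _ _ nU; subst Fk.
exists a1, a2, b1, b2, z, u0, F; split.
- split.
  + rewrite cat_uniq zb andbT; apply/andP; split.
      rewrite /= !inE !negb_or a12 b12 !ab //.
    apply/hasPn => j; rewrite zbU => jU; rewrite !inE !negb_or.
    by rewrite !(neqU _ j).
  + move=> j; rewrite mem_cat zbU orbC.
    by case: (boolP (j \in U)) => // /cover.
  + set ce := chain_edges _.
    have ceU j k : (j, k) \in ce -> j \in U /\ k \in U.
      by case/mem_chain_edges => jz kb; rewrite -!zbU jz inE kb orbT.
    have ceN j k : j \notin U -> ((j, k) \in ce) = false /\ ((k, j) \in ce) = false.
      by move=> jU; split; apply/negP => /ceU[]; rewrite (negbTE jU).
    have tailE j k : j \notin U -> k != j -> inter j k =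
       (((j, k) \in ce ++ [:: (a1, z); (a2, z); (b1, u0); (b2, u0)]) ||
        ((k, j) \in ce ++ [:: (a1, z); (a2, z); (b1, u0); (b2, u0)]) : nat)%:Z.
      move=> jU kj; rewrite !mem_cat !inE !xpair_eqE.
      have [-> ->] := ceN j k jU; rewrite ![j == z]eq_sym ![j == u0]eq_sym.
      rewrite !(neqU j) // !andbF !orbF /=.
      have := cover j jU; rewrite !inE => /or4P[]/eqP jE; subst j.
      * rewrite (inter_tail1 zU a1B kj) eqxx (negbTE a12) !(negbTE (ab _ _ a1B _)) //.
        by rewrite !orbF; case: (k == z).
      * rewrite (inter_tail1 zU a2B kj) eqxx [a2 == a1]eq_sym (negbTE a12).
        rewrite !(negbTE (ab _ _ a2B _)) //.
        by rewrite !orbF; case: (k == z).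
      * rewrite (inter_tail1 u0U b1B kj) eqxx (negbTE b12)
          [b1 == a1]eq_sym [b1 == a2]eq_sym.
        rewrite !(negbTE (ab _ _ _ b1B)) //.
        by rewrite !orbF; case: (k == u0).
      * rewrite (inter_tail1 u0U b2B kj) eqxx [b2 == b1]eq_sym (negbTE b12)
          [b2 == a1]eq_sym [b2 == a2]eq_sym.
        rewrite !(negbTE (ab _ _ _ b2B)) //.
        by rewrite /=; case: (k == u0).
    (* Of two distinct core curves at least one is not the front [z], so symmetry covers the
       remaining case. *)
    have coreE j k : j \in U -> k \in U -> j \in rcons F u0 -> k != j -> inter j k =
       (((j, k) \in ce ++ [:: (a1, z); (a2, z); (b1, u0); (b2, u0)]) ||
        ((k, j) \in ce ++ [:: (a1, z); (a2, z); (b1, u0); (b2, u0)]) : nat)%:Z.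
      move=> jU kU jb kj; rewrite !mem_cat !inE !xpair_eqE.
      rewrite (neqU a1 j) // (neqU a2 j) // (neqU b1 j) // (neqU b2 j) //.
      rewrite (neqU a1 k) // (neqU a2 k) // (neqU b1 k) // (neqU b2 k) //.
      rewrite !orbF f'E //.
      exact: (branch_chain_edges zb br jb kj).
    move=> j k jk; have [jU|jU] := boolP (j \in U); last first.
      by rewrite tailE // eq_sym.
    have [kU|kU] := boolP (k \in U); last by rewrite interC tailE // orbC.
    have : j \in z :: rcons F u0 by rewrite zbU.
    rewrite inE => /orP[/eqP jz|jb]; last by rewrite coreE // eq_sym.
    have kb : k \in rcons F u0.
      by have : k \in z :: rcons F u0; [rewrite zbU|rewrite inE -jz eq_sym (negbTE jk)].
    by rewrite interC coreE // orbC.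
- by move=> x; rewrite !inE => /or4P[]/eqP->.
- move=> i; apply: cover; apply/negP => fU.
  by have [_ nou _] := core _ fU; apply: (nou i).
Qed.

End Classification.

(** * One core curve *)

Section SingleCore.
Local Open Scope ring_scope.
Variables (r : nat) (n : 'I_r -> nat) (G : log_resolution n).
Hypotheses (Gmin : minimal_orbifold_log G) (G2 : (2 <= #|ecomp G|)%N).
Variables (u : ecomp G) (B : ecomp G -> seq (seq (ecomp G))).
Hypothesis UB : peeled [set u] B.
Hypothesis index_sum : (size (B u))%:R - 2 + (1 - (end_weight u)%:R^-1) <=
    \sum_(b <- B u) (tail_index u b)%:~R^-1 :> rat.

Let uU : u \in [set u]. Proof. by rewrite inE. Qed.

Lemma single_core_tail : exists b, b \in B u.
Proof.
have [j ju] : exists j, j != u.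
  apply/existsP; apply: contraTT G2 => /existsPn no; rewrite -leqNgt.
  by rewrite -(card1 u) subset_leq_card //; apply/subsetP => j _;
     rewrite inE -[_ == _]negbK no.
have [|v [b [vU bB _]]] := peeled_cover UB (j := j); first by rewrite inE.
by exists b; move: vU; rewrite inE => /eqP<-.
Qed.

(** All degrees are at most 2, and the far end of a tail has degree 1. *)
Lemma chain_of_single_core : (size (B u) <= 2)%N -> chain_case G.
Proof.
move=> sz; have [tl _ _ _] := UB; have [b bB] := single_core_tail.
have tail_degree c j : c \in B u -> j \in c ->
    \sum_(k | k != j) inter j k = (j != last u c).+1%:Z.
  move=> cB; apply: branch_degree; first exact: (peeled_uniq1 UB).
  by case: (tl u c uU cB).
apply: (@chain_case_of_degrees _ _ _ Gmin G2 (last u b)) => [j|].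
  have [->|ju] := eqVneq j u.
    have := peeled_nbr UB (fun=> 1%:Z) uU.
    under eq_bigr do rewrite mul1r intz.
    under [in RHS]eq_bigr do rewrite mul1r intz.
    move=> ->; rewrite big1 ?add0r => [|k]; last first.
      by rewrite inE => /andP[->].
    by rewrite big_const_seq count_predT iter_addr_0 (ler_nat _ _ 2).
  have [|v [c [vU cB jc]]] := peeled_cover UB (j := j); first by rewrite inE.
  move: vU cB; rewrite inE => /eqP-> cB.
  by rewrite (tail_degree c) //; case: (j != _).
rewrite (tail_degree b) ?eqxx //.
have [+ _ _ _ _] := tl u b uU bB.
by case: (b) => //= y c _; rewrite mem_last.
Qed.

(** The sum of the four 1/(nm) is at least 4 - 2 and each term is at most 1/2, so every index is
    2. *)
Lemma four_branch_of_single_core : size (B u) = 4%N -> four_branch_case G.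
Proof.
move=> sz; have [tl _ _ _] := UB.
have nou : unmet u by apply: (unmet_center UB Gmin G2 uU); rewrite sz.
have idx : forall b, b \in B u -> tail_index u b = 2.
  apply: (tail_index_sum_eq UB uU); move: index_sum.
  by rewrite (end_weight_unmet nou) invr1 sz; lra.
have := fun i => foot_last UB i (erefl _) nou.
have := star_of_peeled UB (erefl _) (perm_refl _).
have half b bB := half_tails Gmin G2 UB uU bB (idx b bB).
case E : (B u) sz => [//|c1 [//|c2 [//|c3 [//|c4 []]]]] // _ star feet.
have cB c : c \in [:: c1; c2; c3; c4] -> c \in B u by rewrite E.
have [|x1 E1 h1] := half c1; first by apply: cB; rewrite !inE eqxx.
have [|x2 E2 h2] := half c2; first by apply: cB; rewrite !inE eqxx ?orbT.
have [|x3 E3 h3] := half c3; first by apply: cB; rewrite !inE eqxx ?orbT.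
have [|x4 E4 h4] := half c4; first by apply: cB; rewrite !inE eqxx ?orbT.
move: star feet; rewrite E1 E2 E3 E4 => star feet.
exists u, x1, x2, x3, x4; split=> //.
- by move=> x; rewrite !inE => /or4P[]/eqP->.
- move=> i; have [b + ->] := feet i.
  by rewrite !inE => /or4P[]/eqP-> /=; rewrite eqxx ?orbT.
Qed.

Lemma three_branch_of_single_core : size (B u) = 3%N -> three_branch_case G.
Proof.
move=> sz; have [tl _ _ _] := UB.
have nou : unmet u by apply: (unmet_center UB Gmin G2 uU); rewrite sz.
pose nm b := (branch_weight u b * branch_det b)%N.
pose bs := sort (relpre nm leq) (B u).
have pB : perm_eq bs (B u) by rewrite perm_sort.
have srt : sorted (relpre nm leq) bs by apply: sort_sorted => x y; apply: leq_total.
have nmE b : b \in bs -> (nm b)%:Z = tail_index u b.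
  by rewrite (perm_mem pB) => bB; apply: (tail_indexE UB uU bB).
have nm2 b : b \in bs -> (2 <= nm b)%N.
  move=> bB; rewrite -lez_nat nmE //; apply: tail_index_ge2; apply: tl => //.
  by rewrite -(perm_mem pB).
have sum1 : 1 <= \sum_(b <- bs) (nm b)%:R^-1 :> rat.
  rewrite big_seq; under eq_bigr => b bB do rewrite [(nm b)%:R]pmulrn nmE //.
  rewrite -big_seq (perm_big _ pB) /=; move: index_sum.
  by rewrite sz (end_weight_unmet nou) invr1; lra.
have feet i : exists2 b, b \in bs & foot i = last u b.
  by have [b bB ib] := foot_last UB i (erefl _) nou; exists b; rewrite ?(perm_mem pB).
have star := star_of_peeled UB (erefl _) pB.
have := perm_size pB; rewrite sz => sz3.
move: star feet sum1 srt nm2; clear nmE.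
case: (bs) sz3 => [//|b1 [//|b2 [//|b3 []]]] // _ star feet sum1 srt nm2.
have [n1 n2 n3] : [/\ (2 <= nm b1)%N, (2 <= nm b2)%N & (2 <= nm b3)%N].
  by split; apply: nm2; rewrite !inE eqxx ?orbT.
move: srt; rewrite /= andbT => /andP[n12 n23].
exists u, b1, b2, b3; split=> //.
- move=> i; have [b + ->] := feet i.
  by rewrite !inE => /or3P[]/eqP->; rewrite eqxx ?orbT.
- by rewrite -/(nm b1) -/(nm b2) -/(nm b3) n12.
- apply: volume_zero_triple_of_sum; [exact/andP|exact: n23|].
  apply: inv_sum3_ge1; [exact: ltnW|exact: ltnW|exact: ltnW|].
  by move: sum1; rewrite !big_cons big_nil addr0 addrA.
Qed.

(** With s tails, s - 2 <= s/2. *)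
Lemma single_core_size : (size (B u) <= 4)%N.
Proof.
have := tail_index_sum UB uU; have /andP[_ ew] := end_weight_inv u.
rewrite -(ler_nat rat); move: index_sum; lra.
Qed.

End SingleCore.

(** Since [L] is effective and the square of E is negative, 2g - 2 + sum (1 - 1/n_i) <= 0; the sum
    is positive because of [i0], so g = 0. *)
Lemma single_curve_case (r : nat) (n : 'I_r -> nat) (G : log_resolution n)
    (i0 : orb n) : #|ecomp G| = 1%N -> orbifold_log G -> has_volume G 0%R ->
  all_rational G /\ chain_case G.
Proof.
move=> G1; rewrite /orbifold_log G1 eqxx => orb2 /volume0_effective[L [LE L0]].
have /card1P[x xE] : #|ecomp G| == 1%N by rewrite G1.
have {}xE j : j = x by apply/eqP; have := xE j; rewrite !inE => <-.
have g0 : genus x = 0%N.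
  have nox : (fun k => k != x) =1 xpred0 by move=> k; rewrite (xE k) eqxx.
  have := LE x; rewrite dotE_split log_canon_dotE !(eq_bigl _ _ nox) !big_pred0_eq.
  have d0 : (0 < \sum_(i : orb n | foot i == x) (1 - (n (val i))%:R^-1) :> rat)%R.
    rewrite (bigD1 i0) /=; last by rewrite (xE (foot i0)).
    have n1 (i : orb n) : (0 < 1 - (n (val i))%:R^-1 :> rat)%R.
      have := valP i; rewrite /= => ni; rewrite subr_gt0 invf_lt1 ?ltr1n //.
      by rewrite ltr0n ltnW.
    by apply: ltr_pwDl; [exact: n1 | rewrite sumr_ge0 // => i _; apply/ltW/n1].
  have s0 : (0 <= (neg_sq x)%:~R * L x :> rat)%R.
    by rewrite mulr_ge0 // ler0z; have := neg_sq_ge1 x; lia.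
  move=> E; apply/eqP; rewrite -leqn0 leqNgt; apply/negP => g1.
  have : (2 <= (2 * genus x)%:R :> rat)%R by rewrite (ler_nat _ 2); lia.
  by move: E; rewrite mulNr; lra.
split; first by move=> j; rewrite (xE j).
have rk (i : orb n) : (enum_rank i < 2)%N.
  by apply: leq_trans (ltn_ord _) _.
(* There are at most two curves C_i, so their ranks 0 and 1 assign them to the two ends of the
   one-curve chain. *)
exists x, [::], (fun i => enum_rank i == 1%N :> nat); split.
- split=> // [j|j k]; first by rewrite (xE j) inE.
  by rewrite (xE j) (xE k) eqxx.
- move=> i j ij; apply: enum_rank_inj; apply: val_inj; move: ij (rk i) (rk j) => /=.
  by case: (nat_of_ord _) => [|[|?]] //; case: (nat_of_ord _) => [|[|?]].
- by move=> i; rewrite (xE (foot i)); case: ifP.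
Qed.

Theorem theorem7p4 (r : nat) (n : 'I_r -> nat)
    (n_gt0 : forall i, (0 < n i)%N)
    (n_ge2 : exists i, (2 <= n i)%N)
    (G : log_resolution n)
    (Gmin : minimal_orbifold_log G)
    (vol0 : has_volume G 0%R) :
  all_rational G /\
  (chain_case G \/
   dihedral_case G \/
   two_node_case G \/
   four_branch_case G \/
   three_branch_case G).
Proof.
have [i ni] := n_ge2; pose i0 : orb n := exist _ i ni.
have [G1|Gn1] := eqVneq #|ecomp G| 1%N.
  have [Gorb _] := Gmin.
  by have [? ?] := single_curve_case i0 G1 Gorb vol0; split; [|left].
have G2 : (2 <= #|ecomp G|)%N by rewrite ltn_neqAle eq_sym Gn1 ecomp_gt0.
have [L [LE L0]] := volume0_effective vol0.
have [U [B [UB Bmax]]] := peel_max Gmin G2.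
have [/cards1P[u Uu]|U1] := boolP (#|U| == 1%N); last first.
  have core u uU := many_core Gmin G2 UB LE L0 Bmax (u := u) uU U1.
  split; last by right; right; left; apply: (two_node_of_peeled Gmin G2 UB i0).
  by apply: (all_rational_peeled UB) => u /core[].
subst U; have [b bB] := single_core_tail G2 UB.
have [|g0 index_sum] := single_core Gmin G2 UB LE L0 (erefl _).
  by case: (B u) bB.
split; first by apply: (all_rational_peeled UB) => j; rewrite inE => /eqP->.
have := single_core_size UB index_sum; rewrite leq_eqVlt ltnS => /orP[/eqP s4|].
  by do 3!right; left; apply: (four_branch_of_single_core Gmin G2 UB).
rewrite leq_eqVlt ltnS => /orP[/eqP s3|s2].
  by do 4!right; apply: (three_branch_of_single_core Gmin G2 UB).
by left; apply: (chain_of_single_core Gmin G2 UB).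
Qed.
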